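(* Let $\mathbb{K}$ be an algebraically closed field and let $A, R, A', A''$ be finite-dimensional $\mathbb{K}$-algebras. Let $\xi: R\to A$ be a split extension of $A$ by a nilpotent $(A,A)$-bimodule $Q$, and let $\mathcal{R}(A',A,A'')$ be a recollement of module categories with functors $i^*, i_*, i^!, j_!, j^*, j_*$. (1) For any exceptional sequence $(M_1,\ldots,M_r)$ in $\mathrm{mod}(A)$, if - $R={}_AR$ is a projective left $A$-module; - $\mathrm{Hom}_A(M_k, M_k\otimes_A Q)=0$ for all $1\leq k\leq r$ and $\mathrm{Hom}_A(M_j, M_i\otimes_A Q)=0$ for all $1\leq i<j\leq r$; - $\mathrm{Ext}^n_A(M_k, M_k\otimes_A Q)=0$ for all $1\leq k\leq r$ and $\mathrm{Ext}^n_A(M_j, M_i\otimes_A Q)=0$ for all $1\leq i<j\leq r$, for every positive integer $n$; then $(M_1\otimes_A R,\ldots,M_r\otimes_A R)$ is an exceptional sequence in $\mathrm{mod}(R)$. (2) For any exceptional sequence $(X_1,\ldots,X_t)$ in $\mathrm{mod}(A')$ and any exceptional sequence $(Y_1,\ldots,Y_u)$ in $\mathrm{mod}(A'')$, if $i^*$ and $i^!$ are exact functors, then $(i_*(X_1),\ldots,i_*(X_t))$ and $(j_!(Y_1),\ldots,j_!(Y_u))$ are exceptional sequences in $\mathrm{mod}(A)$.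
   Context: For a finite-dimensional $\mathbb{K}$-algebra $B$, $\mathrm{mod}(B)$ is the category of finitely generated right $B$-modules. Exceptional sequences: an indecomposable $B$-module $M$ is exceptional if $\mathrm{End}_B(M)\cong\mathbb{K}$ and $\mathrm{Ext}^n_B(M,M)=0$ for every positive integer $n$. A pair $(M_i,M_j)$ of exceptional modules is an exceptional pair if $\mathrm{Hom}_B(M_j,M_i)=0$ and $\mathrm{Ext}^n_B(M_j,M_i)=0$ for every positive integer $n$. A sequence $(M_1,\ldots,M_r)$ of exceptional modules is an exceptional sequence if $(M_i,M_j)$ is an exceptional pair for all $1\leq i<j\leq r$. Split extensions: $R$ is a split extension of $A$ by the nilpotent bimodule $Q$ if $\xi:R\to A$ is a split surjective algebra morphism (i.e. it has a right inverse algebra morphism $A\to R$, which makes $R$ an $(A,A)$-bimodule) whose kernel $Q:=\mathrm{Ker}(\xi)$ is contained in the radical $\mathrm{rad}\,R$. Then ${}_AR_A\cong A\oplus{}_AQ_A$, and $-\otimes_A R:\mathrm{mod}(A)\to\mathrm{mod}(R)$. Recollements: a recollement $\mathcal{R}(\mathcal{A},\mathcal{B},\mathcal{C})$ of abelian categories consists of functors $i_*:\mathcal{A}\to\mathcal{B}$, $i^*,i^!:\mathcal{B}\to\mathcal{A}$, $j^*:\mathcal{B}\to\mathcal{C}$, $j_!,j_*:\mathcal{C}\to\mathcal{B}$ such that (R1) $(i^*,i_* )$, $(i_*,i^!)$, $(j_!,j^* )$, $(j^*,j_* )$ are adjoint pairs (left adjoint listed first); (R2) $i_*$, $j_!$,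 $j_*$ are fully faithful; (R3) $\mathrm{Im}(i_* )=\mathrm{Ker}(j^* )$. A recollement of module categories $\mathcal{R}(A',A,A'')$ means a recollement with $\mathcal{A}=\mathrm{mod}(A')$, $\mathcal{B}=\mathrm{mod}(A)$, $\mathcal{C}=\mathrm{mod}(A'')$. *)

(* Defs.v *)
From HB Require Import structures.
From mathcomp Require Import all_boot all_order all_algebra.

Set Implicit Arguments.
Unset Strict Implicit.
Unset Printing Implicit Defensive.

Import GRing.Theory.
Local Open Scope ring_scope.

(* Finite-dimensional K-algebras: rings with a central morphism k |-> k.1 from
   K, finitely spanned over K. MathComp's falgType is not used because it
   excludes the zero algebra, which does occur as an end term of a recollement
   (e.g. in the trivial recollements with A' = 0 or A'' = 0). *)
Record fdAlgType (K : fieldType) := FdAlg {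
  fdalg_ring :> pzRingType;
  fdalg_scalar : {rmorphism K -> fdalg_ring};
  fdalg_central : forall (k : K) (x : fdalg_ring),
    fdalg_scalar k * x = x * fdalg_scalar k;
  fdalg_fin_dim : exists (n : nat) (g : 'I_n -> fdalg_ring),
    forall x : fdalg_ring, exists c : 'I_n -> K,
      x = \sum_(i < n) fdalg_scalar (c i) * g i
}.

Definition alg_morphism (K : fieldType) (A B : fdAlgType K)
    (f : {rmorphism A -> B}) : Prop :=
  forall k : K, f (fdalg_scalar A k) = fdalg_scalar B k.

(* Right B-modules are left modules over the converse ring B^c, so that m.b
   is written (b : B^c) *: m. *)

Definition fin_gen (S : pzRingType) (M : lmodType S) : Prop :=
  exists (n : nat) (g : 'I_n -> M),
    forall m : M, exists c : 'I_n -> S, m = \sum_(i < n) c i *: g i.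

(* The objects of mod(B); its morphisms are the {linear M -> N}. *)
Record fgmod (B : pzRingType) := FgMod {
  fgmod_sort :> lmodType B^c;
  fgmod_fin_gen : fin_gen fgmod_sort
}.

Definition surjective (X Y : Type) (f : X -> Y) : Prop :=
  forall y, exists x, f x = y.

Definition projective (S : pzRingType) (P : lmodType S) : Prop :=
  forall (M N : lmodType S) (g : {linear M -> N}) (f : {linear P -> N}),
    surjective g -> exists h : {linear P -> M}, forall x, g (h x) = f x.

Definition zero_mod (S : pzRingType) (M : lmodType S) : Prop :=
  forall x : M, x = 0.

Definition iso_mod (S : pzRingType) (M N : lmodType S) : Prop :=
  exists f : {linear M -> N}, bijective f.

Definition indecomposable (B : pzRingType) (M : fgmod B) : Prop :=
  ~ zero_mod M /\
  forall X Y : fgmod B,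
    iso_mod M (X * Y)%type -> zero_mod X \/ zero_mod Y.

Definition hom_zero (B : pzRingType) (M N : fgmod B) : Prop :=
  forall (f : {linear M -> N}) (x : M), f x = 0.

Definition exact_at (S : pzRingType) (X Y Z : lmodType S)
    (f : {linear X -> Y}) (g : {linear Y -> Z}) : Prop :=
  forall y : Y, g y = 0 <-> exists x : X, f x = y.

Record proj_resolution (B : pzRingType) (M : fgmod B) := ProjResolution {
  pr_obj : nat -> fgmod B;
  pr_diff : forall n, {linear pr_obj n.+1 -> pr_obj n};
  pr_aug : {linear pr_obj 0 -> M};
  pr_proj : forall n, projective (pr_obj n);
  pr_aug_surj : surjective pr_aug;
  pr_exact0 : exact_at (pr_diff 0) pr_aug;
  pr_exact : forall n, exact_at (pr_diff n.+1) (pr_diff n)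
}.

Definition cocycle (B : pzRingType) (M N : fgmod B) (P : proj_resolution M)
    (n : nat) (f : {linear pr_obj P n -> N}) : Prop :=
  forall x, f (pr_diff P n x) = 0.

Definition coboundary (B : pzRingType) (M N : fgmod B)
    (P : proj_resolution M) (n : nat) : {linear pr_obj P n -> N} -> Prop :=
  match n with
  | 0 => fun f => forall x, f x = 0
  | m.+1 => fun f => exists g : {linear pr_obj P m -> N},
                       forall x, f x = g (pr_diff P m x)
  end.

(* Ext^n_B(M, N) = H^n(Hom_B(P, N)) for P a projective resolution of M, up to
   an isomorphism that does not depend on P. *)
Definition ext_zero (B : pzRingType) (n : nat) (M N : fgmod B) : Prop :=
  forall (P : proj_resolution M) (f : {linear pr_obj P n -> N}),
    cocycle f -> coboundary f.

(* End_B(M) and K are isomorphic as K-algebras; k in K acts on M as k.1_B. *)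
Definition end_iso_field (K : fieldType) (B : fdAlgType K) (M : fgmod B) :
    Prop :=
  exists phi : K -> {linear M -> M},
    [/\ bijective phi,
        forall (a b : K) (x : M), phi (a + b) x = phi a x + phi b x,
        forall (a b : K) (x : M), phi (a * b) x = phi a (phi b x),
        forall x : M, phi 1 x = x
      & forall (a b : K) (x : M),
          phi (a * b) x = (fdalg_scalar B a : B^c) *: phi b x].

Definition exceptional (K : fieldType) (B : fdAlgType K) (M : fgmod B) :
    Prop :=
  [/\ indecomposable M,
      end_iso_field M
    & forall n : nat, (0 < n)%N -> ext_zero n M M].

Definition exceptional_pair (K : fieldType) (B : fdAlgType K)
    (M N : fgmod B) : Prop :=
  hom_zero N M /\ forall n : nat, (0 < n)%N -> ext_zero n N M.

Definition exceptional_seq (K : fieldType) (B : fdAlgType K) (r : nat)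
    (M : 'I_r -> fgmod B) : Prop :=
  (forall k, exceptional (M k)) /\
  (forall i j : 'I_r, (i < j)%N -> exceptional_pair (M i) (M j)).

Definition right_ideal (R : pzRingType) (I : R -> Prop) : Prop :=
  [/\ I 0,
      forall x y, I x -> I y -> I (x + y)
    & forall x a, I x -> I (x * a)].

Definition maximal_right_ideal (R : pzRingType) (I : R -> Prop) : Prop :=
  [/\ right_ideal I,
      ~ I 1
    & forall J : R -> Prop, right_ideal J -> ~ J 1 ->
        (forall x, I x -> J x) -> forall x, J x -> I x].

Definition radical (R : pzRingType) (x : R) : Prop :=
  forall I : R -> Prop, maximal_right_ideal I -> I x.

(* The section sigma is part of the data: it determines the (A, A)-bimodule
   structures of R and Ker xi. *)
Definition split_extension (K : fieldType) (R A : fdAlgType K)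
    (xi : {rmorphism R -> A}) (sigma : {rmorphism A -> R}) : Prop :=
  [/\ alg_morphism xi,
      alg_morphism sigma,
      surjective xi,
      cancel sigma xi
    & forall x : R, xi x = 0 -> radical x].

(* S as a left A-module by restriction of scalars, a *: x = sigma a * x. *)
Definition restr_lmod (A S : pzRingType) (sigma : {rmorphism A -> S}) : Type :=
  S.

Section RestrLmod.
Variables (A S : pzRingType) (sigma : {rmorphism A -> S}).

HB.instance Definition _ := GRing.Zmodule.on (restr_lmod sigma).

Let act (a : A) (x : restr_lmod sigma) : restr_lmod sigma :=
  sigma a * (x : S).

Fact restr_lmod_scalerA a b x : act a (act b x) = act (a * b) x.
Proof. by rewrite /act rmorphM mulrA. Qed.

Fact restr_lmod_scale1r : left_id 1 act.
Proof. by move=> x; rewrite /act rmorph1 mul1r. Qed.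

Fact restr_lmod_scalerDr : right_distributive act +%R.
Proof. by move=> a x y; rewrite /act mulrDr. Qed.

Fact restr_lmod_scalerDl x : {morph act^~ x : a b / a + b}.
Proof. by move=> a b; rewrite /act rmorphD mulrDl. Qed.

HB.instance Definition _ :=
  GRing.Zmodule_isLmodule.Build A (restr_lmod sigma)
    restr_lmod_scalerA restr_lmod_scale1r
    restr_lmod_scalerDr restr_lmod_scalerDl.

End RestrLmod.

(* A-balanced biadditive maps on M x Q, for Q a left A-module with action
   lact. *)
Definition balanced (A : pzRingType) (M : lmodType A^c) (Q : zmodType)
    (lact : A -> Q -> Q) (Z : zmodType) (b : M -> Q -> Z) : Prop :=
  [/\ forall m m' q, b (m + m') q = b m q + b m' q,
      forall m q q', b m (q + q') = b m q + b m q'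
    & forall m (a : A) q, b ((a : A^c) *: m) q = b m (lact a q)].

(* T, together with t (m, q) = m (x) q, is the right S-module M (x)_A Q, for
   Q an (A, S)-bimodule with actions lact and ract. *)
Definition is_tensor (A S : pzRingType) (M : lmodType A^c) (Q : zmodType)
    (lact : A -> Q -> Q) (ract : Q -> S -> Q)
    (T : lmodType S^c) (t : M -> Q -> T) : Prop :=
  [/\ balanced lact t,
      forall m q (s : S), t m (ract q s) = (s : S^c) *: t m q
    & forall (Z : zmodType) (b : M -> Q -> Z), balanced lact b ->
        exists f : {additive T -> Z},
          (forall m q, f (t m q) = b m q) /\
          (forall g : {additive T -> Z},
             (forall m q, g (t m q) = b m q) -> g =1 f)].

Definition in_ker (R A : pzRingType) (xi : {rmorphism R -> A}) : pred R :=
  fun x => xi x == 0.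

Section Kernel.
Variables (R A : pzRingType) (xi : {rmorphism R -> A}).

Fact in_ker_zmod_closed : zmod_closed (in_ker xi).
Proof.
by split=> [|x y]; rewrite !unfold_in ?rmorph0 // => /eqP x0 /eqP y0;
   rewrite rmorphB x0 y0 subrr.
Qed.

HB.instance Definition _ :=
  GRing.isZmodClosed.Build R (in_ker xi) in_ker_zmod_closed.

Record kernel := Kernel { kernel_val :> R; _ : kernel_val \in in_ker xi }.

HB.instance Definition _ := [isSub for kernel_val].
HB.instance Definition _ := [Choice of kernel by <:].
HB.instance Definition _ := [SubChoice_isSubZmodule of kernel by <:].

Fact kernelP (q : kernel) : xi (val q) = 0.
Proof. exact/eqP/(valP q). Qed.

Fact in_kerMl (a : R) (q : kernel) : a * val q \in in_ker xi.
Proof. by rewrite unfold_in /in_ker rmorphM kernelP mulr0. Qed.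

Fact in_kerMr (q : kernel) (a : R) : val q * a \in in_ker xi.
Proof. by rewrite unfold_in /in_ker rmorphM kernelP mul0r. Qed.

Variable sigma : {rmorphism A -> R}.

Definition ker_lact (a : A) (q : kernel) : kernel :=
  Kernel (in_kerMl (sigma a) q).
Definition ker_ract (q : kernel) (a : A) : kernel :=
  Kernel (in_kerMr q (sigma a)).

Definition is_tensor_ker (M T : fgmod A) (t : M -> kernel -> T) : Prop :=
  is_tensor ker_lact ker_ract t.

Definition is_tensor_ext (M : fgmod A) (T : fgmod R) (t : M -> R -> T) :
    Prop :=
  is_tensor (fun a x => sigma a * x) (fun x s : R => x * s) t.

End Kernel.

(* Covariant functors mod(A) -> mod(B); neither additivity nor K-linearity is
   required. *)
Record mod_functor (A B : pzRingType) := ModFunctor {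
  fobj :> fgmod A -> fgmod B;
  fmap : forall M N : fgmod A, {linear M -> N} -> {linear fobj M -> fobj N};
  fmap_id : forall M : fgmod A, fmap (idfun : {linear M -> M}) =1 id;
  fmap_comp : forall (L M N : fgmod A)
    (g : {linear M -> N}) (f : {linear L -> M}),
    fmap (g \o f : {linear L -> N}) =1 fmap g \o fmap f
}.

Definition adjoint (A B : pzRingType)
    (F : mod_functor A B) (G : mod_functor B A) : Prop :=
  exists phi : forall (X : fgmod A) (Y : fgmod B),
                 {linear F X -> Y} -> {linear X -> G Y},
    (forall X Y, bijective (@phi X Y)) /\
    (forall (X X' : fgmod A) (Y Y' : fgmod B) (f : {linear X' -> X})
            (g : {linear Y -> Y'}) (h : {linear F X -> Y}),
       phi X' Y' (g \o h \o fmap F f : {linear F X' -> Y'})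
         =1 fmap G g \o phi X Y h \o f).

Definition fully_faithful (A B : pzRingType) (F : mod_functor A B) : Prop :=
  forall M N : fgmod A, bijective (@fmap _ _ F M N).

Definition short_exact (B : pzRingType) (X Y Z : fgmod B)
    (f : {linear X -> Y}) (g : {linear Y -> Z}) : Prop :=
  [/\ injective f, exact_at f g & surjective g].

Definition exact_functor (A B : pzRingType) (F : mod_functor A B) : Prop :=
  forall (X Y Z : fgmod A) (f : {linear X -> Y}) (g : {linear Y -> Z}),
    short_exact f g -> short_exact (fmap F f) (fmap F g).

(* The functors i_*, i^*, i^!, j_!, j^*, j_* are i_low, i_up, i_shriek,
   j_shriek, j_up, j_low. Im(i_* ) is the essential image. *)
Record recollement (A' A A'' : pzRingType) := Recollement {
  i_low : mod_functor A' A;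
  i_up : mod_functor A A';
  i_shriek : mod_functor A A';
  j_shriek : mod_functor A'' A;
  j_up : mod_functor A A'';
  j_low : mod_functor A'' A;
  adj_i_up : adjoint i_up i_low;
  adj_i_shriek : adjoint i_low i_shriek;
  adj_j_shriek : adjoint j_shriek j_up;
  adj_j_low : adjoint j_up j_low;
  ff_i_low : fully_faithful i_low;
  ff_j_shriek : fully_faithful j_shriek;
  ff_j_low : fully_faithful j_low;
  im_i_low : forall M : fgmod A,
    (exists X : fgmod A', iso_mod (i_low X) M) <-> zero_mod (j_up M)
}.

(* Main.v *)
Require Import Defs.
From HB Require Import structures.
From mathcomp Require Import all_boot all_order all_algebra.
From mathcomp Require Import boolp.

(** The first part rests on extension of scalars along sigma : A -> R. By
    adjunction, maps over R from M (x) R to N (x) R are maps over A from M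
    to the restriction of N (x) R, and since R is A + Q as an (A,
    A)-bimodule, that restriction is N + N (x) Q ([tensor_ext_split]). As R
    is projective as a left A-module, extension of scalars is exact; it also
    preserves projectives, so it maps a projective resolution of M to one of
    M (x) R. Therefore Ext^n_R(M (x) R, N (x) R) is the sum of Ext^n_A(M, N)
    and Ext^n_A(M, N (x) Q) ([tensor_ext_hom_zero], [tensor_ext_ext_zero]),
    and the hypotheses on Q leave only the first summand; in particular
    every endomorphism of M_k (x) R is a scalar ([tensor_ext_scalar_end]).
    Extension of scalars is realised as an explicit functor: a dual basis
    exhibits R as a direct summand of A^n, and M (x) R is cut out of M^n by
    the corresponding idempotent ([induced], [tensor_ext_iso]).

    In the second part, i_* and j_! are fully faithful, exact, and preserve
    projectives, and any such functor preserves exceptional sequences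
    ([ff_exceptional_seq]). A left adjoint is right exact and a right
    adjoint is left exact, so i_* and j^* are exact and j_! is right exact.
    A left adjoint of a functor preserving surjections preserves
    projectives, which applies to i_* because i^! is exact and to j_!
    because j^* is. That j_! preserves injections follows from exactness of
    i^* ([j_shriek_inj]).

    The functors of a recollement need not be K-linear, so full faithfulness
    gives only an isomorphism of monoids between End(F X) and K. This is
    enough over an algebraically closed field: an endomorphism f of F X has
    an eigenvalue k, so f - k is not invertible, hence zero
    ([ff_scalar_end]). A nonzero module whose endomorphisms are scalars is
    indecomposable with endomorphism algebra K ([scalar_end_exceptional]).

    All modules are finitely generated over finite-dimensional algebras, so
    that kernels and cokernels stay in the category ([fin_gen_sub]),
    projective resolutions exist ([std_resolution]), and the vanishing of
    Ext can be tested on a single one of them ([ext_zero_resolution]). *)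

Set Implicit Arguments.
Unset Strict Implicit.
Unset Printing Implicit Defensive.

Import GRing.Theory.
Local Open Scope ring_scope.

(** * Linear maps, submodules, quotients, restriction of scalars *)

Definition lin_of (S : pzRingType) (U V : lmodType S) (f : U -> V)
    (f_lin : linear f) : {linear U -> V} :=
  HB.pack f (GRing.isLinear.Build S U V _ f f_lin).

Lemma lin_ext (S : pzRingType) (U V : lmodType S) (f g : {linear U -> V}) :
  f =1 g -> f = g.
Proof.
case: f => f [[f1] [f2]]; case: g => g [[g1] [g2]] /= /funext fg.
move: f1 f2 g1 g2; rewrite /= in fg *; subst g => f1 f2 g1 g2.
by rewrite (Prop_irrelevance f1 g1) (Prop_irrelevance f2 g2).
Qed.

Lemma bij_lin_inv (S : pzRingType) (U V : lmodType S) (f : {linear U -> V}) :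
  bijective f ->
  exists g : {linear V -> U}, cancel f g /\ cancel g f.
Proof.
case=> g fK gK; have g_lin : linear g.
  by move=> a x y; apply: (can_inj fK); rewrite linearP !gK.
by exists (lin_of g_lin).
Qed.

Lemma inj_surj_bij (X Y : Type) (f : X -> Y) :
  injective f -> surjective f -> bijective f.
Proof.
by move=> f_inj /choice[g gK]; exists g => // x; apply: f_inj; rewrite gK.
Qed.

Lemma lin_inj (S : pzRingType) (U V : lmodType S) (f : {linear U -> V}) :
  (forall x, f x = 0 -> x = 0) -> injective f.
Proof.
move=> f0 x y fxy; apply/eqP; rewrite -subr_eq0; apply/eqP/f0.
by rewrite linearB fxy subrr.
Qed.

(** The predicate is a proposition, so that kernels and images are submodules
    as they stand; excluded middle supplies the boolean predicate needed for
    a subtype. *)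
Record submodule (S : pzRingType) (M : lmodType S) := Submodule {
  sm_pred :> M -> Prop;
  sm0 : sm_pred 0;
  smP : forall a x y, sm_pred x -> sm_pred y -> sm_pred (a *: x + y)
}.

Definition sm_mem (S : pzRingType) (M : lmodType S) (L : submodule M) :
  pred M := fun x => `[< L x >].

Section Submodule.
Variables (S : pzRingType) (M : lmodType S) (L : submodule M).

Fact sm_mem_closed : subsemimod_closed (sm_mem L).
Proof.
split; first split.
- exact/asboolP/sm0.
- by move=> x y /asboolP Lx /asboolP Ly; apply/asboolP;
     rewrite -[x]scale1r; apply: smP.
- by move=> a x /asboolP Lx; apply/asboolP; rewrite -[_ *: _]addr0;
     apply: smP => //; apply: sm0.
Qed.

HB.instance Definition _ :=
  GRing.isSubmodClosed.Build S M (sm_mem L) sm_mem_closed.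

Record sub_of := SubOf { sub_val : M; _ : sub_val \in sm_mem L }.

HB.instance Definition _ := [isSub for sub_val].
HB.instance Definition _ := [Choice of sub_of by <:].
HB.instance Definition _ := [SubChoice_isSubLmodule of sub_of by <:].

Lemma sub_valP (x : sub_of) : L (val x).
Proof. exact/asboolP/(valP x). Qed.

Fact sub_inc_lin : linear (val : sub_of -> M).
Proof. by move=> a x y; rewrite linearP. Qed.

Definition sub_inc : {linear sub_of -> M} := lin_of sub_inc_lin.

Lemma sub_inc_inj : injective sub_inc.
Proof. exact: val_inj. Qed.

Lemma sub_inc_surj x : L x -> exists y, sub_inc y = x.
Proof. by move=> /asboolP Lx; exists (SubOf Lx). Qed.

Lemma sub_incP x : L (sub_inc x).
Proof. exact: sub_valP. Qed.

Lemma sub_corestr (N : lmodType S) (f : {linear N -> M}) :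
  (forall x, L (f x)) ->
  exists g : {linear N -> sub_of}, forall x, sub_inc (g x) = f x.
Proof.
move=> Lf; pose g x := SubOf (asboolT (Lf x)).
have g_lin : linear g.
  by move=> a x y; apply: val_inj; rewrite [RHS]linearP /= linearP.
by exists (lin_of g_lin).
Qed.

End Submodule.

Section Kernel_image.
Variables (S : pzRingType) (M N : lmodType S) (f : {linear M -> N}).

Definition ker_sub : submodule M.
Proof.
exists (fun x => f x = 0); first exact: linear0.
by move=> a x y fx fy; rewrite linearP fx fy scaler0 addr0.
Defined.

Definition im_sub : submodule N.
Proof.
exists (fun y => exists x, f x = y); first by exists 0; rewrite linear0.
by move=> a _ _ [x <-] [y <-]; exists (a *: x + y); rewrite linearP.
Defined.

Definition pre_sub (L : submodule N) : submodule M.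
Proof.
exists (fun x => L (f x)); first by rewrite linear0; apply: sm0.
by move=> a x y Lx Ly; rewrite linearP; apply: smP.
Defined.

End Kernel_image.

Section Quotient.
Variables (S : pzRingType) (M : lmodType S) (L : submodule M).

Let closed : zmodClosed M := GRing.ZmodClosed.clone M (sm_mem L) _.

Definition quot_of := Quotient.quot closed.

HB.instance Definition _ := GRing.Zmodule.on quot_of.

Definition quot_pi (x : M) : quot_of := \pi_(Quotient.quot closed)%qT x.

Lemma quot_piD x y : quot_pi (x + y) = quot_pi x + quot_pi y.
Proof. exact: Quotient.pi_add. Qed.

Lemma quot_pi_surj : surjective quot_pi.
Proof. by move=> y; exists (repr y); rewrite /quot_pi reprK. Qed.

Lemma quot_pi_eq x y : quot_pi x = quot_pi y <-> L (x - y).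
Proof.
have -> : L (x - y) <-> (x - y \in sm_mem L) by split=> /asboolP.
rewrite Quotient.idealrBE; split=> [|/eqP //]; rewrite /quot_pi => ->.
exact: eqxx.
Qed.

Let act (a : S) (y : quot_of) : quot_of := quot_pi (a *: repr y).

Let act_pi a x : act a (quot_pi x) = quot_pi (a *: x).
Proof.
apply/quot_pi_eq; rewrite -scalerBr -[_ *: _]addr0; apply: smP; last exact: sm0.
by apply/quot_pi_eq; rewrite /quot_pi reprK.
Qed.

Fact quot_scalerA a b x : act a (act b x) = act (a * b) x.
Proof. by case: (quot_pi_surj x) => {}x <-; rewrite !act_pi scalerA. Qed.

Fact quot_scale1r : left_id 1 act.
Proof.
by move=> x; case: (quot_pi_surj x) => {}x <-; rewrite act_pi scale1r.
Qed.

Fact quot_scalerDr : right_distributive act +%R.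
Proof.
move=> a x y; case: (quot_pi_surj x) => {}x <-.
case: (quot_pi_surj y) => {}y <-.
by rewrite -quot_piD !act_pi scalerDr quot_piD.
Qed.

Fact quot_scalerDl x : {morph act^~ x : a b / a + b}.
Proof.
case: (quot_pi_surj x) => {}x <- a b.
by rewrite !act_pi scalerDl quot_piD.
Qed.

HB.instance Definition _ := GRing.Zmodule_isLmodule.Build S quot_of
  quot_scalerA quot_scale1r quot_scalerDr quot_scalerDl.

Fact quot_pi_lin : linear quot_pi.
Proof. by move=> a x y; rewrite quot_piD -[quot_pi (a *: x)]act_pi. Qed.

Definition quot_proj : {linear M -> quot_of} := lin_of quot_pi_lin.

Lemma quot_proj_surj : surjective quot_proj.
Proof. exact: quot_pi_surj. Qed.

Lemma quot_proj_eq0 x : quot_proj x = 0 <-> L x.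
Proof.
have := quot_pi_eq x 0; rewrite subr0 => <-.
by rewrite -[quot_pi 0]/(quot_proj 0) linear0.
Qed.

End Quotient.

Definition res_mod (S S' : pzRingType) (f : {rmorphism S -> S'})
  (M : lmodType S') : Type := M.

Section Restriction.
Variables (S S' : pzRingType) (f : {rmorphism S -> S'}) (M : lmodType S').

HB.instance Definition _ := GRing.Zmodule.on (res_mod f M).

Let act (a : S) (x : res_mod f M) : res_mod f M := f a *: (x : M).

Fact res_scalerA a b x : act a (act b x) = act (a * b) x.
Proof. by rewrite /act scalerA rmorphM. Qed.

Fact res_scale1r : left_id 1 act.
Proof. by move=> x; rewrite /act rmorph1 scale1r. Qed.

Fact res_scalerDr : right_distributive act +%R.
Proof. by move=> a x y; rewrite /act scalerDr. Qed.

Fact res_scalerDl x : {morph act^~ x : a b / a + b}.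
Proof. by move=> a b; rewrite /act rmorphD scalerDl. Qed.

HB.instance Definition _ := GRing.Zmodule_isLmodule.Build S (res_mod f M)
  res_scalerA res_scale1r res_scalerDr res_scalerDl.

Lemma res_scaleE (a : S) (x : M) : a *: (x : res_mod f M) = f a *: x :> M.
Proof. by []. Qed.

End Restriction.

Lemma res_lin_fact (S S' : pzRingType) (f : {rmorphism S -> S'})
    (M N : lmodType S') (g : {linear M -> N}) :
  linear (g : res_mod f M -> res_mod f N).
Proof. by move=> a x y; exact: (linearP g (f a)). Qed.

Definition res_lin (S S' : pzRingType) (f : {rmorphism S -> S'})
    (M N : lmodType S') (g : {linear M -> N}) :
  {linear res_mod f M -> res_mod f N} := lin_of (@res_lin_fact S S' f M N g).

Definition res_sub (S S' : pzRingType) (f : {rmorphism S -> S'})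
  (M : lmodType S') (L : submodule M) : submodule (res_mod f M).
Proof.
apply: (@Submodule S (res_mod f M) (sm_pred L)); first exact: sm0.
by move=> a x y Lx Ly; exact: (smP (f a) Lx Ly).
Defined.

(** * Finiteness over finite-dimensional algebras *)

Lemma fin_gen_fintype (S : pzRingType) (M : lmodType S) (I : finType)
    (g : I -> M) :
  (forall m, exists c : I -> S, m = \sum_i c i *: g i) -> fin_gen M.
Proof.
move=> gP; exists #|I|, (g \o enum_val) => m; have [c ->] := gP m.
exists (c \o enum_val).
by rewrite (reindex (@enum_val I I)) //=; apply/onW_bij/enum_val_bij.
Qed.

Lemma fin_gen_surj (S : pzRingType) (M N : lmodType S) (f : {linear M -> N}) :
  fin_gen M -> surjective f -> fin_gen N.
Proof.
case=> n [g gP] f_surj; exists n, (f \o g) => y; have [x <-] := f_surj y.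
have [c ->] := gP x; exists c; rewrite linear_sum.
by apply: eq_bigr => i _; rewrite linearZ.
Qed.

Definition comb (S : pzRingType) (M : lmodType S) n (g : 'I_n -> M)
  (u : 'rV[S]_n) : M := \sum_i u 0 i *: g i.

Fact comb_lin (S : pzRingType) (M : lmodType S) n (g : 'I_n -> M) :
  linear (comb g).
Proof.
move=> a u v; rewrite /comb scaler_sumr -big_split; apply: eq_bigr => i _ /=.
by rewrite !mxE scalerDl scalerA.
Qed.

Definition comb_map (S : pzRingType) (M : lmodType S) n (g : 'I_n -> M) :
  {linear 'rV[S]_n -> M} := lin_of (comb_lin g).

Lemma comb_surj (S : pzRingType) (M : lmodType S) n (g : 'I_n -> M) :
  (forall m, exists c : 'I_n -> S, m = \sum_i c i *: g i) ->
  surjective (comb_map g).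
Proof.
move=> gP m; have [c ->] := gP m; exists (\row_i c i).
by apply: eq_bigr => i _; rewrite mxE.
Qed.

Lemma row_as_comb (S : pzRingType) n (u : 'rV[S]_n) :
  u = \sum_i u 0 i *: (delta_mx 0 i : 'rV[S]_n).
Proof. exact: row_sum_delta. Qed.

Lemma comb_delta (S : pzRingType) (M : lmodType S) n (g : 'I_n -> M) i :
  comb_map g (delta_mx 0 i) = g i.
Proof.
rewrite /= /comb (bigD1 i) //= mxE !eqxx scale1r big1 ?addr0 // => j ji.
by rewrite mxE eqxx (negPf ji) scale0r.
Qed.

Lemma fin_gen_free (S : pzRingType) n : fin_gen ('rV[S]_n : lmodType S).
Proof.
exists n, (fun i => delta_mx 0 i) => u; exists (fun i => u 0 i).
exact: row_as_comb.
Qed.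

Lemma free_projective (S : pzRingType) n : projective ('rV[S]_n : lmodType S).
Proof.
move=> M N g f /choice[s sK]; exists (comb_map (fun i => s (f (delta_mx 0 i)))).
move=> u; rewrite [in RHS](row_as_comb u) /= /comb !linear_sum.
by apply: eq_bigr => i _; rewrite !linearZ sK.
Qed.

(** A subspace of K^n is the row space of a matrix: adjoining to a matrix with
    rows in the subspace a vector that its rows do not span raises the rank. *)
Lemma subspace_mx (K : fieldType) n (P : submodule ('rV[K]_n : lmodType K)) :
  exists A : 'M[K]_n, (forall u : 'rV_n, P (u *m A)) /\
                      (forall v, P v -> (v <= A)%MS).
Proof.
suff H k (A : 'M[K]_n) : (forall u : 'rV_n, P (u *m A)) ->
    (n <= k + \rank A)%N ->
    exists A : 'M[K]_n, (forall u : 'rV_n, P (u *m A)) /\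
                        (forall v, P v -> (v <= A)%MS).
  by apply: (H n 0); rewrite ?leq_addr // => u; rewrite mulmx0; apply: sm0.
(* k bounds the corank of A. *)
elim: k A => [|k IHk] A PA rkA.
  exists A; split=> // v _; apply: submx_full.
  by rewrite /row_full eqn_leq rank_leq_row.
have [AP|/existsNP[v /not_implyP[Pv vA]]] :=
  pselect (forall v, P v -> (v <= A)%MS); first by exists A.
apply: (IHk (A + v)%MS) => [u|].
  have /sub_addsmxP[[u1 u2] /= ->] : (u *m (A + v)%MS <= A + v)%MS.
    exact: submxMl.
  have -> : u2 *m v = u2 0 0 *: v.
    by rewrite {1}[u2]mx11_scalar mul_scalar_mx.
  by rewrite addrC; apply: smP.
apply: leq_trans rkA _; rewrite addSnnS leq_add2l.
have := mxrank_leqif_sup (addsmxSl A v).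
rewrite ltn_neqAle => -[-> ->]; rewrite andbT addsmx_sub.
by apply/negP => /andP[_ /vA].
Qed.

Lemma fin_gen_sub_field (K : fieldType) (V : lmodType K) (L : submodule V) :
  fin_gen V -> fin_gen (sub_of L).
Proof.
case=> n [g /comb_surj gP].
have [A [PA AP]] := subspace_mx (pre_sub (comb_map g) L).
pose f u := comb_map g (u *m A).
have f_lin : linear f by move=> a u v; rewrite /f mulmxDl -scalemxAl linearP.
have [h hE] : exists h : {linear 'rV[K]_n -> sub_of L},
    forall u, sub_inc L (h u) = lin_of f_lin u.
  exact: sub_corestr.
apply: (fin_gen_surj (f := h)); first exact: fin_gen_free.
move=> x; have [u ux] := gP (sub_inc L x).
have /AP/submxP[w uw] : pre_sub (comb_map g) L u.
  by rewrite /= -[comb _ _]/(comb_map g u) ux; apply: sub_incP.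
exists w; apply: (@sub_inc_inj _ _ L); rewrite hE -ux uw.
by [].
Qed.

Section Scalars.
Variables (K : fieldType) (B : fdAlgType K).

Definition scal_op (k : K) : B^c := fdalg_scalar B k.

Fact scal_op_zmod : zmod_morphism scal_op.
Proof. exact: (rmorphB (fdalg_scalar B)). Qed.

Fact scal_op_monoid : monoid_morphism scal_op.
Proof.
split=> [|a b]; first exact: (rmorph1 (fdalg_scalar B)).
rewrite mulrC; exact: (rmorphM (fdalg_scalar B)).
Qed.

HB.instance Definition _ :=
  GRing.isZmodMorphism.Build K B^c scal_op scal_op_zmod.
HB.instance Definition _ :=
  GRing.isMonoidMorphism.Build K B^c scal_op scal_op_monoid.

Lemma scal_op_central k (b : B^c) : scal_op k * b = b * scal_op k.
Proof. by have /esym := fdalg_central k (b : B). Qed.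

Definition vect (M : lmodType B^c) : lmodType K := res_mod scal_op M.

Fact scal_lin_fact (M : lmodType B^c) k :
  linear (fun x : M => scal_op k *: x).
Proof. by move=> a x y; rewrite scalerDr !scalerA scal_op_central. Qed.

Definition scal_lin (M : lmodType B^c) k : {linear M -> M} :=
  lin_of (@scal_lin_fact M k).

(** If the b_j span B over K and the g_i generate M over B, the products
    g_i.b_j span M over K; the scalars are central, so it does not matter on
    which side of b_j they are written. *)
Lemma fin_gen_vect (M : lmodType B^c) : fin_gen M -> fin_gen (vect M).
Proof.
case=> n [g gP]; have [d [b bP]] := fdalg_fin_dim B.
pose h (ij : 'I_n * 'I_d) : vect M := (b ij.2 : B^c) *: g ij.1.
apply: (@fin_gen_fintype _ _ _ h) => m; have [c ->] := gP m.
have /choice[e eP] i : exists e : 'I_d -> K,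
    c i = \sum_j fdalg_scalar B (e j) * b j by exact: bP.
exists (fun ij => e ij.1 ij.2).
rewrite -(pair_big xpredT xpredT (fun i j => e i j *: h (i, j))) /=.
apply: eq_bigr => i _; rewrite eP scaler_suml; apply: eq_bigr => j _.
rewrite /h /= res_scaleE scalerA fdalg_central.
by [].
Qed.

Lemma fin_gen_of_vect (M : lmodType B^c) : fin_gen (vect M) -> fin_gen M.
Proof.
case=> n [g gP]; exists n, g => m; have [c ->] := gP m.
by exists (scal_op \o c).
Qed.

(** Noetherianity: a finitely generated module over a finite-dimensional
    algebra has finite dimension over K, hence so do its submodules, and K
    acts through B. *)
Lemma fin_gen_sub (M : lmodType B^c) (L : submodule M) :
  fin_gen M -> fin_gen (sub_of L).
Proof.
move=> /fin_gen_vect Mfg.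
pose LK : submodule (vect M) := res_sub _ L.
have [n [g gP]] := fin_gen_sub_field LK Mfg.
have /choice[h hE] (x : sub_of LK) :
    exists y : sub_of L, sub_inc L y = sub_inc LK x.
  by apply: sub_inc_surj; exact: (sub_incP x).
apply: fin_gen_of_vect; exists n, (h \o g) => m.
have [m' m'E] : exists m', sub_inc LK m' = sub_inc L m.
  by apply: sub_inc_surj; exact: (sub_incP m).
have [c cE] := gP m'; exists c; apply: (@sub_inc_inj _ _ L).
rewrite -m'E cE !linear_sum; apply: eq_bigr => i _.
rewrite linearZ /= -[LHS]/(scal_op (c i) *: (sub_inc LK (g i) : M)) -hE.
by rewrite -linearZ.
Qed.

End Scalars.

Section Subquotients.
Variables (K : fieldType) (B : fdAlgType K) (M : fgmod B) (L : submodule M).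

Definition sub_fg : fgmod B := FgMod (fin_gen_sub L (fgmod_fin_gen M)).

Definition quot_fg : fgmod B :=
  FgMod (fin_gen_surj (fgmod_fin_gen M) (@quot_proj_surj _ _ L)).

End Subquotients.

Definition free_fg (B : pzRingType) n : fgmod B :=
  FgMod (fin_gen_free B^c n).

(** * Projective resolutions *)

Definition zero_lin (S : pzRingType) (M N : lmodType S) : {linear M -> N} :=
  \0.

Lemma zero_linE (S : pzRingType) (M N : lmodType S) (x : M) :
  zero_lin M N x = 0.
Proof. by []. Qed.

Definition fg_projective (B : pzRingType) (P : fgmod B) : Prop :=
  forall (M N : fgmod B) (g : {linear M -> N}) (f : {linear P -> N}),
    surjective g -> exists h : {linear P -> M}, forall x, g (h x) = f x.

(** Lifting against finitely generated modules already makes a finitely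
    generated module a direct summand of a free one. *)
Lemma fg_projectiveW (B : pzRingType) (P : fgmod B) :
  fg_projective P -> projective P.
Proof.
move=> Pproj; have [n [g /comb_surj g_surj]] := fgmod_fin_gen P.
have [s sK] := Pproj (free_fg B n) P (comb_map g) idfun g_surj.
move=> M N p f /(@free_projective _ n _ _ p (f \o comb_map g))[h hE].
by exists (h \o s) => x; rewrite /= hE /= -[comb _ _]/(comb_map g _) sK.
Qed.

Lemma proj_lift_im (S : pzRingType) (P M N : lmodType S)
    (g : {linear M -> N}) (f : {linear P -> N}) :
  projective P -> (forall x, exists y, g y = f x) ->
  exists h : {linear P -> M}, forall x, g (h x) = f x.
Proof.
move=> Pproj im_f.
have [f' f'E] : exists f' : {linear P -> sub_of (im_sub g)},
  forall x, sub_inc (im_sub g) (f' x) = f x by exact: sub_corestr.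
have [g' g'E] : exists g' : {linear M -> sub_of (im_sub g)},
  forall x, sub_inc (im_sub g) (g' x) = g x.
  by apply: sub_corestr => x; exists x.
have [z|h hE] := Pproj _ _ g' f'.
  have [x xE] := sub_incP z; exists x; apply: (@sub_inc_inj _ _ (im_sub g)).
  by rewrite g'E xE.
by exists h => x; rewrite -g'E hE f'E.
Qed.

(** Chain maps and homotopies are built degree by degree, in types that
    depend on the degree: each choice must satisfy a condition that makes the
    next one possible. *)
Lemma dependent_choice (T : nat -> Type) (good : forall n, T n -> Prop)
    (rel : forall n, T n -> T n.+1 -> Prop) (x0 : T 0) :
  good 0 x0 ->
  (forall n x, good n x -> exists y, good n.+1 y /\ rel n x y) ->
  exists s : forall n, T n,
    [/\ s 0 = x0, forall n, good n (s n) & forall n, rel n (s n) (s n.+1)].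
Proof.
move=> good0 step; pose G n := {x : T n | good n x}.
pose next n (x : G n) : G n.+1 :=
  let: exist y yP := cid (step n _ (svalP x)) in exist _ y (proj1 yP).
have nextP n (x : G n) : rel n (sval x) (sval (next n x)).
  by rewrite /next; case: cid => y [].
pose fix s n : G n := if n is m.+1 then next m (s m) else exist _ x0 good0.
exists (fun n => sval (s n)); split=> [//|n|n]; last exact: nextP.
exact: (svalP (s n)).
Qed.

Section Comparison.
Variable B : pzRingType.

(** The n-cycles of the augmented resolution. *)
Definition cyc (M : fgmod B) (P : proj_resolution M) n :
    pr_obj P n -> Prop :=
  match n with
  | 0 => fun x => pr_aug P x = 0
  | m.+1 => fun x => pr_diff P m x = 0
  end.

Lemma cycP (M : fgmod B) (P : proj_resolution M) n (x : pr_obj P n) :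
  cyc x <-> exists y, pr_diff P n y = x.
Proof.
by case: n x => [|n] x; [exact: pr_exact0 | exact: pr_exact].
Qed.

Lemma cyc_diff (M : fgmod B) (P : proj_resolution M) n x :
  cyc (pr_diff P n x).
Proof. by apply/cycP; exists x. Qed.

Lemma cyc_lift (M : fgmod B) (P : proj_resolution M) n (X : fgmod B)
    (f : {linear X -> pr_obj P n}) :
  projective X -> (forall x, cyc (f x)) ->
  exists h : {linear X -> pr_obj P n.+1}, forall x, pr_diff P n (h x) = f x.
Proof. by move=> Xproj Zf; apply: proj_lift_im => // x; apply/cycP. Qed.

(** The condition carried along the recursion is that a_n maps cycles to
    cycles: then a_n d lands in the cycles, that is in the image of d, and
    lifts because P_{n+1} is projective. *)
Lemma chain_lift (M : fgmod B) (P Q : proj_resolution M) :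
  exists a : forall n, {linear pr_obj P n -> pr_obj Q n},
    (forall x, pr_aug Q (a 0 x) = pr_aug P x) /\
    (forall n x, pr_diff Q n (a n.+1 x) = a n (pr_diff P n x)).
Proof.
have [a0 a0E] : exists a0 : {linear pr_obj P 0 -> pr_obj Q 0},
    forall x, pr_aug Q (a0 x) = pr_aug P x.
  by apply: (@pr_proj _ _ P 0); apply: pr_aug_surj.
have [||a [aE _ aP]] := @dependent_choice
  (fun n => {linear pr_obj P n -> pr_obj Q n})
  (fun n a => forall x, cyc x -> cyc (a x))
  (fun n a b => forall x, pr_diff Q n (b x) = a (pr_diff P n x)) a0.
- by move=> x /= x0; rewrite a0E.
- move=> n a aZ.
  have [|b bE] := @cyc_lift _ Q n _ (a \o pr_diff P n) (@pr_proj _ _ P n.+1).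
    by move=> x; apply/aZ/cyc_diff.
  by exists b; split=> // x /= x0; rewrite bE /= x0 linear0.
by exists a; split=> // x; rewrite aE.
Qed.

(** The condition carried along is that x - c x = d (s x) on cycles; it puts
    the image of 1 - c_{n+1} - s_n d inside the cycles, so s_{n+1} exists. *)
Lemma homotopy_id (M : fgmod B) (P : proj_resolution M)
    (c : forall n, {linear pr_obj P n -> pr_obj P n}) :
  (forall x, pr_aug P (c 0 x) = pr_aug P x) ->
  (forall n x, pr_diff P n (c n.+1 x) = c n (pr_diff P n x)) ->
  exists s : forall n, {linear pr_obj P n -> pr_obj P n.+1},
    (forall x, x - c 0 x = pr_diff P 0 (s 0 x)) /\
    (forall n x,
       x - c n.+1 x = pr_diff P n.+1 (s n.+1 x) + s n (pr_diff P n x)).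
Proof.
move=> c_aug cP.
have [|s0 s0E] := @cyc_lift _ P 0 _ (idfun \- c 0) (@pr_proj _ _ P 0).
  by move=> x; rewrite /= linearB /= c_aug subrr.
have [||s [sE _ sP]] := @dependent_choice
  (fun n => {linear pr_obj P n -> pr_obj P n.+1})
  (fun n s => forall x, cyc x -> x - c n x = pr_diff P n (s x))
  (fun n s t => forall x,
     x - c n.+1 x = pr_diff P n.+1 (t x) + s (pr_diff P n x)) s0.
- by move=> x _; rewrite s0E.
- move=> n s sZ; pose f := (idfun \- c n.+1) \- (s \o pr_diff P n).
  have [|t tE] := @cyc_lift _ P n.+1 _ f (@pr_proj _ _ P n.+1).
    move=> x; rewrite /= !linearB /= cP -sZ ?subrr //; exact: cyc_diff.
  exists t; split=> x => [/= x0|]; rewrite tE /f /=.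
    by rewrite x0 linear0 subr0.
  by rewrite subrK.
by exists s; split=> // x; rewrite sE s0E.
Qed.

(** Any two resolutions are homotopy equivalent, so one of them decides
    whether an Ext group vanishes. *)
Lemma ext_zero_resolution (M N : fgmod B) (P : proj_resolution M) n :
  (forall f : {linear pr_obj P n -> N}, cocycle f -> coboundary f) ->
  ext_zero n M N.
Proof.
move=> PN Q f f_cocycle.
have [a [a_aug aP]] := chain_lift Q P; have [b [b_aug bP]] := chain_lift P Q.
have [||s [s0 sP]] := @homotopy_id _ Q (fun n => b n \o a n).
- by move=> x; rewrite /= b_aug a_aug.
- by move=> m x; rewrite /= bP aP.
have /PN : cocycle (P := P) (f \o b n).
  by move=> x; rewrite /= -bP f_cocycle.
case: n f f_cocycle PN => [|n] f f_cocycle PN /= fb => [x|].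
  by rewrite -[x](subrK (b 0 (a 0 x))) s0 linearD f_cocycle fb addr0.
have [g gE] := fb; exists ((g \o a n) \+ (f \o s n)) => x /=.
rewrite -[x in LHS](subrK (b n.+1 (a n.+1 x))) sP !linearD /=.
by rewrite f_cocycle gE aP add0r addrC.
Qed.

End Comparison.

Section Existence.
Variables (K : fieldType) (B : fdAlgType K).

Record cover (M : fgmod B) := Cover {
  cov_obj : fgmod B;
  cov_map : {linear cov_obj -> M};
  cov_proj : projective cov_obj;
  cov_surj : surjective cov_map
}.

Definition free_cover (M : fgmod B) : cover M.
Proof.
have [n /cid[g gP]] := cid (fgmod_fin_gen M).
exact: (@Cover M (free_fg B n) (comb_map g) (@free_projective _ n)
  (comb_surj gP)).
Qed.

Definition syzygy (M : fgmod B) : fgmod B :=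
  sub_fg (ker_sub (cov_map (free_cover M))).

Variable M : fgmod B.

Let Om n : fgmod B := iter n syzygy M.

Let diff n : {linear cov_obj (free_cover (Om n.+1)) ->
                     cov_obj (free_cover (Om n))} :=
  sub_inc (ker_sub (cov_map (free_cover (Om n)))) \o
    cov_map (free_cover (Om n.+1)).

Let diff_im n y :
  cov_map (free_cover (Om n)) y = 0 <-> exists x, diff n x = y.
Proof.
split=> [y0|[x <-]]; last exact: (sub_incP (cov_map (free_cover (Om n.+1)) x)).
have [z zE] := sub_inc_surj (L := ker_sub _) y0.
by have [x xE] := @cov_surj _ (free_cover (Om n.+1)) z; exists x; rewrite /= xE.
Qed.

Let diff_exact n : exact_at (diff n.+1) (diff n).
Proof.
move=> y; rewrite -diff_im; split=> [|y0]; last by rewrite /= y0.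
by move=> dy; apply: (@sub_inc_inj _ _ (ker_sub _)); rewrite linear0.
Qed.

(** Syzygies are submodules of finitely generated modules, hence finitely
    generated, so that free covers can be iterated inside mod(B). *)
Definition std_resolution : proj_resolution M :=
  @ProjResolution B M (fun n => cov_obj (free_cover (Om n))) diff
    (cov_map (free_cover M)) (fun n => @cov_proj _ (free_cover (Om n)))
    (@cov_surj _ (free_cover M)) (@diff_im 0) diff_exact.

End Existence.

(** * Functors between module categories *)

Lemma fmap_ext (A B : pzRingType) (F : mod_functor A B) (M N : fgmod A)
    (f g : {linear M -> N}) : f =1 g -> fmap F f = fmap F g.
Proof. by move=> /lin_ext ->. Qed.

Definition zero_fg (B : pzRingType) : fgmod B := free_fg B 0.

Lemma zero_fgP (B : pzRingType) : zero_mod (zero_fg B).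
Proof. by move=> x; apply/rowP => -[]. Qed.

(** A zero map factors through the zero module; this replaces the additivity
    of F. *)
Lemma fmap0 (A B : pzRingType) (F : mod_functor A B) :
  zero_mod (F (zero_fg A)) ->
  forall (M N : fgmod A) (f : {linear M -> N}),
    (forall x, f x = 0) -> forall x, fmap F f x = 0.
Proof.
move=> F0 M N f f0 x.
have -> : fmap F f = fmap F (zero_lin (zero_fg A) N \o zero_lin M _).
  by apply: fmap_ext => y; exact: f0.
by rewrite fmap_comp /= (F0 (fmap F _ x)) linear0.
Qed.

Lemma inj_zero (S : pzRingType) (M N : lmodType S) (f : {linear M -> N}) :
  injective f -> zero_mod N -> zero_mod M.
Proof. by move=> f_inj N0 x; apply: f_inj; rewrite (N0 (f x)) linear0. Qed.

(** Elements of a module are maps from the free module of rank one. *)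
Definition point (B : pzRingType) (M : fgmod B) (x : M) :
  {linear free_fg B 1 -> M} := comb_map (fun _ : 'I_1 => x).

Lemma pointE (B : pzRingType) (M : fgmod B) (x : M) :
  point x (delta_mx 0 0) = x.
Proof. exact: comb_delta. Qed.

Lemma point0 (B : pzRingType) (M : fgmod B) u : point (0 : M) u = 0.
Proof. by apply: big1 => i _; rewrite scaler0. Qed.

Lemma point_comp (B : pzRingType) (M N : fgmod B) (f : {linear M -> N}) x u :
  f (point x u) = point (f x) u.
Proof.
by rewrite /= /comb linear_sum; apply: eq_bigr => i _; rewrite linearZ.
Qed.

Section Exact_functor.
Variables (K L : fieldType) (A : fdAlgType K) (B : fdAlgType L).
Variables (F : mod_functor A B) (F_exact : exact_functor F).

Lemma exact_fmap_zero : zero_mod (F (zero_fg A)).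
Proof.
have [] := @F_exact (zero_fg A) (zero_fg A) (zero_fg A) idfun idfun.
  split=> //; last by move=> y; exists y.
  by move=> y; split=> // _; [exists y | exact: zero_fgP].
by move=> _ F0 _ x; rewrite -[LHS]fmap_id; apply/F0; exists x; apply: fmap_id.
Qed.

Lemma exact_fmap_inj (M N : fgmod A) (f : {linear M -> N}) :
  injective f -> injective (fmap F f).
Proof.
move=> f_inj; have [] // := @F_exact M N (quot_fg (im_sub f)) f (quot_proj _).
split=> //; [exact: (@quot_proj_eq0 _ _ (im_sub f)) | exact: quot_proj_surj].
Qed.

Lemma exact_fmap_surj (M N : fgmod A) (f : {linear M -> N}) :
  surjective f -> surjective (fmap F f).
Proof.
move=> f_surj; have [] // := @F_exact (sub_fg (ker_sub f)) M N (sub_inc _) f.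
split=> //; first exact: sub_inc_inj.
move=> y; split=> [|[x <-]]; first exact: (@sub_inc_surj _ _ (ker_sub f)).
exact: (@sub_incP _ _ (ker_sub f)).
Qed.

(** An exact pair f, g is spliced from short exact sequences through the
    kernel and the image of g. *)
Lemma exact_fmap_exact (X Y Z : fgmod A) (f : {linear X -> Y})
    (g : {linear Y -> Z}) :
  exact_at f g -> exact_at (fmap F f) (fmap F g).
Proof.
move=> fg; pose k : {linear sub_fg (ker_sub g) -> Y} := sub_inc _.
pose m : {linear sub_fg (im_sub g) -> Z} := sub_inc _.
have [f' f'E] : exists f' : {linear X -> sub_fg (ker_sub g)},
    forall x, k (f' x) = f x.
  by apply: sub_corestr => x; apply/fg; exists x.
have [g' g'E] : exists g' : {linear Y -> sub_fg (im_sub g)},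
    forall x, m (g' x) = g x.
  by apply: sub_corestr => x; exists x.
have k_inj : injective k by exact: sub_inc_inj.
have m_inj : injective m by exact: sub_inc_inj.
have f'_surj : surjective f'.
  move=> z; have /fg[x xE] := sub_incP z.
  by exists x; apply: k_inj; rewrite f'E.
have g'_surj : surjective g'.
  by move=> z; have [y yE] := sub_incP z; exists y; apply: m_inj; rewrite g'E.
have [_ kg' _] : short_exact (fmap F k) (fmap F g').
  apply: F_exact; split=> // y; have -> : g' y = 0 <-> g y = 0.
    rewrite -g'E; split=> [->|]; first exact: linear0.
    by rewrite -(linear0 m) => /m_inj.
  split=> [|[z <-]]; first exact: (@sub_inc_surj _ _ (ker_sub g)).
  exact: (@sub_incP _ _ (ker_sub g)).
have gE : fmap F g = fmap F (m \o g').
  by apply: fmap_ext => y; exact: esym (g'E y).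
have fE : fmap F f = fmap F (k \o f').
  by apply: fmap_ext => x; exact: esym (f'E x).
move=> y; split=> [|[x <-]].
  rewrite gE fmap_comp /= => my0; have /kg'[z <-] : fmap F g' y = 0.
    by apply: (exact_fmap_inj m_inj); rewrite my0 linear0.
  by have [x <-] := exact_fmap_surj f'_surj z; exists x; rewrite fE fmap_comp.
rewrite -[LHS]fmap_comp; apply: fmap0 => [|u]; first exact: exact_fmap_zero.
by apply/fg; exists u.
Qed.

Hypothesis F_proj : forall P : fgmod A, projective P -> projective (F P).

(** The augmentation is corrected by an isomorphism e, so that the result
    resolves any module isomorphic to F M. *)
Definition map_resolution (M : fgmod A) (P : proj_resolution M) (N : fgmod B)
    (e : {linear F M -> N}) (e_bij : bijective e) : proj_resolution N.
Proof.
apply: (@ProjResolution B N (fun n => F (pr_obj P n))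
  (fun n => fmap F (pr_diff P n)) (e \o fmap F (pr_aug P))).
- by move=> n; apply: F_proj; apply: pr_proj.
- have [e' _ eK] := e_bij; move=> y.
  have [x xE] := exact_fmap_surj (@pr_aug_surj _ _ P) (e' y).
  by exists x; rewrite /= xE eK.
- move=> y; rewrite -(exact_fmap_exact (@pr_exact0 _ _ P)) /=.
  by split=> [|->]; rewrite ?linear0 // -{1}(linear0 e) => /(bij_inj e_bij).
- by move=> n; apply: exact_fmap_exact; apply: pr_exact.
Defined.

End Exact_functor.

(** * Exactness properties of adjoint functors *)

Section Adjoint.
Variables (A B : pzRingType) (F : mod_functor A B) (G : mod_functor B A).
Hypothesis FG : adjoint F G.

Lemma adjointP : exists (phi : forall (X : fgmod A) (Y : fgmod B),
                            {linear F X -> Y} -> {linear X -> G Y})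
    (psi : forall (X : fgmod A) (Y : fgmod B),
             {linear X -> G Y} -> {linear F X -> Y}),
  [/\ forall X Y, cancel (phi X Y) (psi X Y),
      forall X Y, cancel (psi X Y) (phi X Y),
      forall (X : fgmod A) (Y Y' : fgmod B) (g : {linear Y -> Y'})
        (h : {linear F X -> Y}),
        phi X Y' (g \o h : {linear F X -> Y'}) =1 fmap G g \o phi X Y h
    & forall (X X' : fgmod A) (Y : fgmod B) (f : {linear X' -> X})
        (h : {linear F X -> Y}),
        phi X' Y (h \o fmap F f : {linear F X' -> Y}) =1 phi X Y h \o f].
Proof.
have [phi [phi_bij phiP]] := FG.
have psi X Y : {psi | cancel (phi X Y) psi /\ cancel psi (phi X Y)}.
  by apply: cid; case: (phi_bij X Y) => psi; exists psi.
exists phi, (fun X Y => sval (psi X Y)).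
split=> [X Y|X Y|X Y Y' g h x|X X' Y f h x].
- exact: (proj1 (svalP (psi X Y))).
- exact: (proj2 (svalP (psi X Y))).
- have := phiP X X Y Y' idfun g h x; rewrite /= => <-; congr (phi _ _ _ x).
  by apply: lin_ext => y; rewrite /= fmap_id.
have := phiP X X' Y Y f idfun h x; rewrite /= fmap_id => <-.
by congr (phi _ _ _ x); apply: lin_ext.
Qed.

Lemma hom_subsingleton_zero (S : pzRingType) (M : lmodType S) :
  (forall f g : {linear M -> M}, f = g) -> zero_mod M.
Proof.
by move=> H x; have := congr1 (fun h : {linear M -> M} => h x)
  (H idfun (zero_lin M M)).
Qed.

Lemma right_adj_zero (Y : fgmod B) : zero_mod Y -> zero_mod (G Y).
Proof.
have [phi [psi [_ psiK _ _]]] := adjointP => Y0.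
apply: hom_subsingleton_zero => f g; rewrite -(psiK _ _ f) -(psiK _ _ g).
by congr (phi _ _ _); apply: lin_ext => x; rewrite [LHS]Y0 [RHS]Y0.
Qed.

Lemma left_adj_zero (X : fgmod A) : zero_mod X -> zero_mod (F X).
Proof.
have [phi [psi [phiK _ _ _]]] := adjointP => X0.
apply: hom_subsingleton_zero => f g; rewrite -(phiK _ _ f) -(phiK _ _ g).
by congr (psi _ _ _); apply: lin_ext => x; rewrite (X0 x) !linear0.
Qed.

(** The adjunction bijection respects zero maps because they factor through
    the zero module, which a right adjoint preserves. *)
Lemma adjoint0P : exists (phi : forall (X : fgmod A) (Y : fgmod B),
                            {linear F X -> Y} -> {linear X -> G Y})
    (psi : forall (X : fgmod A) (Y : fgmod B),
             {linear X -> G Y} -> {linear F X -> Y}),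
  [/\ forall X Y, cancel (phi X Y) (psi X Y),
      forall X Y, cancel (psi X Y) (phi X Y),
      forall (X : fgmod A) (Y Y' : fgmod B) (g : {linear Y -> Y'})
        (h : {linear F X -> Y}),
        phi X Y' (g \o h : {linear F X -> Y'}) =1 fmap G g \o phi X Y h,
      forall (X X' : fgmod A) (Y : fgmod B) (f : {linear X' -> X})
        (h : {linear F X -> Y}),
        phi X' Y (h \o fmap F f : {linear F X' -> Y}) =1 phi X Y h \o f
    & forall X Y, phi X Y (zero_lin _ _) = zero_lin _ _].
Proof.
have [phi [psi [phiK psiK natr natl]]] := adjointP.
exists phi, psi; split=> // X Y; apply: lin_ext => x /=.
have -> : zero_lin (F X) Y = zero_lin (zero_fg B) Y \o zero_lin (F X) _.
  exact: lin_ext.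
by rewrite natr /= (right_adj_zero (@zero_fgP B) (phi _ _ _ x)) linear0.
Qed.

(** A map killed by G f corresponds to a map killed by f; maps out of the free
    module of rank one turn this into a statement on elements. *)
Lemma right_adj_inj (X Y : fgmod B) (f : {linear X -> Y}) :
  injective f -> injective (fmap G f).
Proof.
have [phi [psi [phiK psiK natr _ phi0]]] := adjoint0P => f_inj.
apply: lin_inj => x fx0; rewrite -(pointE x) -(psiK _ _ (point x)).
suff -> : psi _ _ (point x) = zero_lin _ _ by rewrite phi0.
apply: lin_ext => u; apply: f_inj; rewrite zero_linE linear0.
suff : (f \o psi _ _ (point x) : {linear F (free_fg A 1) -> Y}) =
    zero_lin _ _.
  by move/(congr1 (fun h : {linear _ -> Y} => h u)).
rewrite -[LHS]phiK -[RHS]phiK phi0; congr (psi _ _ _); apply: lin_ext => v.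
by rewrite natr psiK -[LHS]/(fmap G f (point x v)) point_comp fx0 point0.
Qed.

(** The element y of ker(G g) corresponds to a map out of F(A) killed by g,
    which factors through f since f is a kernel of g; the factor corresponds
    to a preimage of y. *)
Lemma right_adj_exact (X Y Z : fgmod B) (f : {linear X -> Y})
    (g : {linear Y -> Z}) :
  injective f -> exact_at f g -> exact_at (fmap G f) (fmap G g).
Proof.
move=> f_inj fg; have [phi [psi [phiK psiK natr _ phi0]]] := adjoint0P.
move=> y; split=> [gy0|[x <-]]; last first.
  rewrite -[LHS]fmap_comp; apply: fmap0 => [|z].
    exact/right_adj_zero/zero_fgP.
  by apply/fg; exists z.
pose yh := psi _ _ (point y).
have g_yh : (g \o yh : {linear F (free_fg A 1) -> Z}) = zero_lin _ _.
  rewrite -[LHS]phiK -[RHS]phiK phi0; congr (psi _ _ _); apply: lin_ext => v.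
  by rewrite natr psiK -[LHS]/(fmap G g (point y v)) point_comp gy0 point0.
have /choice[z zE] u : exists z, f z = yh u.
  by apply/fg; move/(congr1 (fun h : {linear _ -> Z} => h u)): g_yh.
have z_lin : linear z.
  by move=> a u v; apply: f_inj; rewrite linearP !zE linearP.
exists (phi _ _ (lin_of z_lin) (delta_mx 0 0)).
rewrite -[LHS]natr -[RHS]pointE -(psiK _ _ (point y)).
by congr (phi _ _ _ _); apply: lin_ext => u; rewrite /= zE.
Qed.

End Adjoint.

(** A map out of F Y killing the image of F f corresponds to a map out of Y
    killing the image of f; this applies to the cokernel of F f. *)
Lemma left_adj_surj (K L : fieldType) (A : fdAlgType K) (B : fdAlgType L)
    (F : mod_functor A B) (G : mod_functor B A) (X Y : fgmod A)
    (f : {linear X -> Y}) :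
  adjoint F G -> surjective f -> surjective (fmap F f).
Proof.
move=> FG f_surj; have [phi [psi [phiK psiK _ natl phi0]]] := adjoint0P FG.
pose p : {linear F Y -> quot_fg (im_sub (fmap F f))} := quot_proj _.
have pf0 : (p \o fmap F f : {linear F X -> quot_fg _}) = zero_lin _ _.
  by apply: lin_ext => x; apply/(@quot_proj_eq0 _ _ (im_sub _)); exists x.
move=> y; apply/(@quot_proj_eq0 _ _ (im_sub _)).
rewrite -[LHS]/(p y) -[p]phiK.
suff -> : phi _ _ p = phi _ _ (zero_lin _ _) by rewrite phiK.
apply: lin_ext => z; have [x <-] := f_surj z.
by rewrite -[LHS]natl pf0 !phi0.
Qed.

(** With p the cokernel of F f, the map corresponding to p kills the image of
    f, so it factors through g; hence p factors through F g and kills ker(F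
    g). *)
Lemma left_adj_exact (K L : fieldType) (A : fdAlgType K) (B : fdAlgType L)
    (F : mod_functor A B) (G : mod_functor B A) (X Y Z : fgmod A)
    (f : {linear X -> Y}) (g : {linear Y -> Z}) :
  adjoint F G -> exact_at f g -> surjective g ->
  exact_at (fmap F f) (fmap F g).
Proof.
move=> FG fg g_surj; have [phi [psi [phiK psiK _ natl phi0]]] := adjoint0P FG.
move=> y; split=> [gy0|[x <-]]; last first.
  rewrite -[LHS]fmap_comp; apply: fmap0 => [|z].
    exact/(left_adj_zero FG)/zero_fgP.
  by apply/fg; exists z.
pose p : {linear F Y -> quot_fg (im_sub (fmap F f))} := quot_proj _.
have pf0 : (p \o fmap F f : {linear F X -> quot_fg _}) = zero_lin _ _.
  by apply: lin_ext => x; apply/(@quot_proj_eq0 _ _ (im_sub _)); exists x.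
apply/(@quot_proj_eq0 _ _ (im_sub _)); rewrite -[LHS]/(p y).
have phi_p y' : g y' = 0 -> phi _ _ p y' = 0.
  by move=> /fg[x <-]; rewrite -[LHS]natl pf0 phi0.
have /choice[s sK] := g_surj; pose c z := phi _ _ p (s z).
have cg y' : c (g y') = phi _ _ p y'.
  apply/eqP; rewrite -subr_eq0 -linearB; apply/eqP/phi_p.
  by rewrite linearB sK subrr.
have c_lin : linear c.
  by move=> a u v; rewrite -(sK u) -(sK v) -linearP !cg linearP.
have -> : p = (psi _ _ (lin_of c_lin) \o fmap F g : {linear F Y -> quot_fg _}).
  rewrite -[LHS]phiK -[RHS]phiK; congr (psi _ _ _); apply: lin_ext => y'.
  by rewrite natl psiK /= cg.
by rewrite /= gy0 linear0.
Qed.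

(** Lifting problems against F P correspond to lifting problems against P. *)
Lemma left_adj_projective (A B : pzRingType) (F : mod_functor A B)
    (G : mod_functor B A) (P : fgmod A) :
  adjoint F G ->
  (forall (X Y : fgmod B) (f : {linear X -> Y}),
     surjective f -> surjective (fmap G f)) ->
  projective P -> projective (F P).
Proof.
move=> FG G_surj Pproj; apply: fg_projectiveW => M N g f /G_surj Gg_surj.
have [phi [psi [phiK psiK natr _ _]]] := adjoint0P FG.
have [h hE] := Pproj _ _ _ (phi _ _ f) Gg_surj.
exists (psi _ _ h) => x.
suff : (g \o psi _ _ h : {linear F P -> N}) = f.
  by move/(congr1 (fun k : {linear F P -> N} => k x)).
rewrite -[LHS]phiK -[RHS]phiK; congr (psi _ _ _); apply: lin_ext => y.
by rewrite natr psiK /= hE.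
Qed.

(** * Exceptional modules over an algebraically closed field *)

Section Scalar_endomorphisms.
Variables (K : closedFieldType) (B : fdAlgType K).

Definition scalar_end (M : fgmod B) : Prop :=
  forall f : {linear M -> M}, exists k, forall x, f x = scal_op B k *: x.

Lemma end_iso_scalar (M : fgmod B) : end_iso_field M -> scalar_end M.
Proof.
case=> phi [[psi _ psiK] _ _ phi1 phiZ] f; exists (psi f) => x.
by rewrite -{1}(psiK f) -[psi f in LHS]mulr1 phiZ phi1.
Qed.

Lemma scal_unit (M : fgmod B) k (x : M) :
  k != 0 -> scal_op B k *: x = 0 -> x = 0.
Proof.
move=> k0 kx; rewrite -[x]scale1r -(rmorph1 (scal_op B)) -(mulVf k0).
by rewrite rmorphM -scalerA kx scaler0.
Qed.

Lemma scal_inj (M : fgmod B) (k l : K) :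
  ~ zero_mod M -> (forall x : M, scal_op B k *: x = scal_op B l *: x) -> k = l.
Proof.
move=> M0 kl; apply/eqP; rewrite -subr_eq0; apply/negPn/negP => kl0.
apply: M0 => x; apply: (scal_unit kl0).
by rewrite rmorphB scalerBl kl subrr.
Qed.

(** A decomposition gives an idempotent endomorphism; an idempotent scalar is
    0 or 1. *)
Lemma scalar_end_indecomposable (M : fgmod B) :
  ~ zero_mod M -> scalar_end M -> indecomposable M.
Proof.
move=> M0 M_scal; split=> // X Y [f f_bij].
have [g [fK gK]] := bij_lin_inv f_bij.
pose e (m : M) := g ((f m).1, 0).
have e_lin : linear e.
  by move=> a x y; rewrite /e -linearP; congr (g (_, _));
    rewrite ?linearP //= scaler0 addr0.
have [k kP] := M_scal (lin_of e_lin).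
have [k0|k0] := eqVneq k 0.
  left=> x; have := kP (g (x, 0)); rewrite /= /e gK /= k0 rmorph0 scale0r.
  by move/(congr1 f); rewrite gK linear0 => -[].
right=> y; have := kP (g (0, y)); rewrite /= /e gK /=.
have -> : ((0 : X), (0 : Y)) = 0 by [].
rewrite linear0 => /esym/(scal_unit k0)/(congr1 f).
by rewrite gK linear0 => -[].
Qed.

Lemma scalar_end_exceptional (M : fgmod B) :
  ~ zero_mod M -> scalar_end M -> (forall n, (0 < n)%N -> ext_zero n M M) ->
  exceptional M.
Proof.
move=> M0 M_scal M_ext; split=> //; first exact: scalar_end_indecomposable.
exists (@scal_lin K B M); split=> [|a b x|a b x|x|a b x] /=.
- apply: inj_surj_bij => [k l kl|f].
    apply: (scal_inj M0) => x.
    exact: (congr1 (fun h : {linear M -> M} => h x) kl).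
  by have [k kP] := M_scal f; exists k; apply: lin_ext => x.
- by rewrite rmorphD scalerDl.
- by rewrite rmorphM scalerA.
- by rewrite rmorph1 scale1r.
- by rewrite rmorphM scalerA.
Qed.

(** The characteristic polynomial of a matrix inducing f annihilates f and
    splits into linear factors, which cannot all act injectively. *)
Lemma exists_eigenvector (M : fgmod B) (f : {linear M -> M}) :
  ~ zero_mod M -> exists k (x : M), x <> 0 /\ f x = scal_op B k *: x.
Proof.
move=> M0; have [x x0] : exists x : M, x <> 0.
  apply: contrapT => H; apply: M0 => x; apply: contrapT => x0.
  by apply: H; exists x.
have [n [g gP]] := fin_gen_vect (fgmod_fin_gen M).
have r_surj := comb_surj gP.
case: n => [|n] in g gP r_surj *.
  by case: x0; have [c ->] := gP x; rewrite big_ord0.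
set r := comb_map g in r_surj; pose fK := res_lin (scal_op B) f.
have /choice[c cE] i : exists c : 'rV[K]_n.+1, r c = fK (g i) by exact: r_surj.
pose C := \matrix_(i < n.+1) c i.
have rC u : fK (r u) = r (u *m C).
  rewrite mulmx_sum_row (linear_sum r).
  rewrite -[LHS]/(fK (\sum_i u 0 i *: g i)) (linear_sum fK).
  by apply: eq_bigr => i _; rewrite linearZ [RHS]linearZ rowK cE.
have [rs p_rs] := closed_field_poly_normal (char_poly C).
have prod0 : \prod_(z <- rs) (C - z%:M) = 0.
  have := Cayley_Hamilton C; rewrite p_rs (monicP (char_poly_monic C)) scale1r.
  rewrite rmorph_prod => H; rewrite -[RHS]H; apply: eq_bigr => z _.
  by rewrite rmorphB /= horner_mx_X horner_mx_C.
have [u ux] := r_surj x.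
have {x0 ux} ru0 : r u <> 0 by rewrite ux.
have : r (u *m \prod_(z <- rs) (C - z%:M)) = 0 by rewrite prod0 mulmx0 linear0.
elim: rs u ru0 {p_rs prod0} => [|z rs IHrs] u ru0.
  by rewrite big_nil mulmx1.
rewrite big_cons -[_ * _]/(_ *m _) mulmxA.
have [uz|uz] := pselect (r (u *m (C - z%:M)) = 0); last exact: IHrs.
move=> _; exists z, (r u); split=> //; apply/eqP; rewrite -subr_eq0; apply/eqP.
by rewrite -[RHS]uz mulmxBr linearB -rC mul_mx_scalar (linearZZ r).
Qed.

End Scalar_endomorphisms.

Section Fully_faithful.
Variables (K : closedFieldType) (A B : fdAlgType K) (F : mod_functor A B).
Hypothesis F_ff : fully_faithful F.

Lemma ff_inj (M N : fgmod A) (f g : {linear M -> N}) :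
  fmap F f =1 fmap F g -> f = g.
Proof. by move=> /lin_ext/(bij_inj (F_ff M N)). Qed.

Lemma ff_full (M N : fgmod A) (f : {linear F M -> F N}) :
  exists g, f = fmap F g.
Proof. by have [h _ hK] := F_ff M N; exists (h f). Qed.

(** If F M = 0 then End(M) is in bijection with End(F M), which has one
    element. *)
Lemma ff_nonzero (M : fgmod A) : ~ zero_mod M -> ~ zero_mod (F M).
Proof.
move=> M0 FM0; apply: M0; apply: hom_subsingleton_zero => f g.
by apply: ff_inj => x; rewrite [LHS]FM0 [RHS]FM0.
Qed.

(** F need not be additive or linear, but End(F M) is isomorphic to K
    as a monoid, so its nonzero elements are invertible. If k is an eigenvalue
    of f, then f - k is not invertible, hence zero. *)
Lemma ff_scalar_end (M : fgmod A) :
  ~ zero_mod M -> end_iso_field M -> scalar_end (F M).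
Proof.
move=> M0 [phi [[psi _ psiK] _ phiM phi1 phiZ]] f.
have [k [y [y0 fy]]] := exists_eigenvector f (ff_nonzero M0).
pose h : {linear F M -> F M} := f \- scal_lin (F M) k.
have hy : h y = 0 by rewrite /= fy subrr.
have [h' hE] := ff_full h; set c := psi h'.
have h'E : h' = phi c by rewrite psiK.
have c0 : c = 0.
  apply/eqP/negPn/negP => cN0; apply: y0.
  have : fmap F (phi c^-1 \o phi c : {linear M -> M}) y = 0.
    by rewrite fmap_comp /= -h'E -hE hy linear0.
  have -> : fmap F (phi c^-1 \o phi c : {linear M -> M}) =
            fmap F (idfun : {linear M -> M}).
    by apply: fmap_ext => x; rewrite /= -phiM mulVf // phi1.
  by rewrite fmap_id.
exists k => x; apply/eqP; rewrite -subr_eq0; apply/eqP.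
rewrite -[LHS]/(h x).
(* F (phi 0) absorbs every endomorphism of F M, in particular 0. *)
have [z zE] := ff_full (zero_lin (F M) (F M)).
have : fmap F (h' \o z : {linear M -> M}) x = 0.
  by rewrite fmap_comp /= -zE linear0.
suff -> : fmap F (h' \o z : {linear M -> M}) = fmap F h' by rewrite -hE.
by apply: fmap_ext => u; rewrite /= h'E c0 -(psiK z) -!phiM mul0r.
Qed.

Hypothesis F_exact : exact_functor F.
Hypothesis F_proj : forall P : fgmod A, projective P -> projective (F P).

(** F maps a projective resolution P of M to one of F M, and Hom(F P, F N) is
    Hom(P, N) because F is fully faithful. *)
Lemma ff_ext_zero (M N : fgmod A) n :
  ext_zero n M N -> ext_zero n (F M) (F N).
Proof.
move=> MN; have id_bij : bijective (idfun : {linear F M -> F M}) by exists id.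
pose P := std_resolution M.
apply: (@ext_zero_resolution _ _ _ (map_resolution F_exact F_proj P id_bij)).
move=> f f_cocycle.
have [g gE] : exists g : {linear pr_obj P n -> N}, f = fmap F g.
  exact: ff_full.
have /MN : cocycle (P := P) g.
  move=> x.
  suff : (g \o pr_diff P n : {linear pr_obj P n.+1 -> N}) = zero_lin _ _.
    by move/(congr1 (fun k : {linear _ -> N} => k x)).
  apply: ff_inj => y; rewrite fmap_comp /= -gE f_cocycle.
  by rewrite (fmap0 (exact_fmap_zero F_exact)).
case: n g f f_cocycle gE MN => [|n] g f f_cocycle -> MN /=.
  by move=> g0 x; apply: fmap0 => //; apply: exact_fmap_zero.
case=> h hE; exists (fmap F h) => x.
have -> : fmap F g = fmap F (h \o pr_diff P n) by exact: fmap_ext.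
by rewrite fmap_comp.
Qed.

Lemma ff_exceptional_seq r (X : 'I_r -> fgmod A) :
  exceptional_seq X -> exceptional_seq (fun k => F (X k)).
Proof.
case=> X_exc X_pair; split=> [k|i j ij].
  have [[X0 _] X_end X_ext] := X_exc k.
  apply: scalar_end_exceptional; first exact: ff_nonzero.
    exact: ff_scalar_end.
  by move=> n n0; apply/ff_ext_zero/X_ext.
have [X_hom X_ext] := X_pair _ _ ij; split=> [f x|n n0]; last first.
  exact/ff_ext_zero/X_ext.
have [g gE] := ff_full f; have [z zE] := ff_full (zero_lin (F (X j)) (F (X i))).
have -> : f = zero_lin _ _; last by [].
by rewrite gE zE; apply: fmap_ext => u; rewrite [LHS]X_hom [RHS]X_hom.
Qed.

End Fully_faithful.

(** * Recollements *)

(** By naturality, composition with the unit of Y is F followed by the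
    adjunction bijection, so it is bijective on maps from any module to Y,
    and the unit is an isomorphism by the Yoneda argument. *)
Lemma ff_unit_bij (A B : pzRingType) (F : mod_functor A B)
    (G : mod_functor B A) :
  adjoint F G -> fully_faithful F ->
  exists eta : forall X : fgmod A, {linear X -> G (F X)},
    (forall X, bijective (eta X)) /\
    (forall (X Y : fgmod A) (f : {linear X -> Y}) x,
       eta Y (f x) = fmap G (fmap F f) (eta X x)).
Proof.
move=> FG F_ff; have [phi [psi [phiK psiK natr natl _]]] := adjoint0P FG.
pose eta (Y : fgmod A) : {linear Y -> G (F Y)} := phi Y (F Y) idfun.
have etaE (Y Y' : fgmod A) (f : {linear Y -> Y'}) y :
    eta Y' (f y) = phi _ _ (fmap F f) y.
  by rewrite -[LHS]natl; congr (phi _ _ _ _); apply: lin_ext.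
exists eta; split=> [Y|Y Y' f y]; last first.
  by rewrite etaE -[RHS]natr; congr (phi _ _ _ _); apply: lin_ext.
have [h _ hK] := F_ff (G (F Y)) Y.
pose s := h (psi _ _ (idfun : {linear G (F Y) -> G (F Y)})).
have etaK y : eta Y (s y) = y by rewrite etaE hK psiK.
exists s => // y.
have [h' h'K _] := F_ff Y Y.
suff : fmap F (s \o eta Y : {linear Y -> Y}) = fmap F (idfun : {linear Y -> Y}).
  move/(can_inj h'K) => sE.
  exact: (congr1 (fun k : {linear Y -> Y} => k y) sE).
rewrite -[LHS]phiK -[RHS]phiK; congr (psi _ _ _); apply: lin_ext => z.
by rewrite -!etaE /= etaK.
Qed.

Section Recollement.
Variables (K : closedFieldType) (A' A A'' : fdAlgType K).
Variable Rec : recollement A' A A''.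
Hypothesis i_up_exact : exact_functor (i_up Rec).
Hypothesis i_shriek_exact : exact_functor (i_shriek Rec).

Lemma i_low_exact : exact_functor (i_low Rec).
Proof.
move=> X Y Z f g [f_inj fg g_surj]; split.
- exact: (right_adj_inj (adj_i_up Rec)).
- exact: (right_adj_exact (adj_i_up Rec)).
- exact: (left_adj_surj (adj_i_shriek Rec)).
Qed.

Lemma i_low_projective (P : fgmod A') :
  projective P -> projective (i_low Rec P).
Proof.
apply: left_adj_projective (adj_i_shriek Rec) _ => X Y f.
exact: (exact_fmap_surj i_shriek_exact).
Qed.

Lemma j_shriek_projective (P : fgmod A'') :
  projective P -> projective (j_shriek Rec P).
Proof.
apply: left_adj_projective (adj_j_shriek Rec) _ => X Y f.
exact: (left_adj_surj (adj_j_low Rec)).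
Qed.

Lemma j_up_i_low (X : fgmod A') : zero_mod (j_up Rec (i_low Rec X)).
Proof. by apply/im_i_low; exists X; exists idfun; exists id. Qed.

(** Maps out of i^*(j_! Y) correspond to maps from j_! Y to i_* Z, then to
    maps from Y to j^*(i_* Z) = 0. *)
Lemma i_up_j_shriek (Y : fgmod A'') : zero_mod (i_up Rec (j_shriek Rec Y)).
Proof.
have [phi [psi [phiK _ _ _ _]]] := adjoint0P (adj_i_up Rec).
have [phi' [psi' [phiK' _ _ _ _]]] := adjoint0P (adj_j_shriek Rec).
apply: hom_subsingleton_zero => f g; rewrite -(phiK _ _ f) -(phiK _ _ g).
congr (psi _ _ _); rewrite -[LHS]phiK' -[RHS]phiK'; congr (psi' _ _ _).
by apply: lin_ext => y; rewrite [LHS]j_up_i_low [RHS]j_up_i_low.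
Qed.

(** The kernel of j_! f vanishes under j^*, because j^* is left exact and
    j^* j_! is the identity; hence it is isomorphic to some i_* Z. As i^* is
    exact, i^* of the kernel embeds into i^*(j_! X) = 0. So every map from
    the kernel to i_* Z is zero, in particular the isomorphism. *)
Lemma j_shriek_inj (X Y : fgmod A'') (f : {linear X -> Y}) :
  injective f -> injective (fmap (j_shriek Rec) f).
Proof.
move=> f_inj; have [eta [eta_bij eta_nat]] :=
  ff_unit_bij (adj_j_shriek Rec) (ff_j_shriek Rec).
set Jf := fmap _ f; pose Ker := sub_fg (ker_sub Jf).
pose k : {linear Ker -> _} := sub_inc (ker_sub Jf).
have k_inj : injective k by exact: sub_inc_inj.
have JJf_inj : injective (fmap (j_up Rec) Jf).
  move=> x x'; have [e _ eK] := eta_bij X; rewrite -(eK x) -(eK x').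
  by rewrite -!eta_nat => /(bij_inj (eta_bij Y))/f_inj ->.
have jKer : zero_mod (j_up Rec Ker).
  move=> z; apply: (right_adj_inj (adj_j_shriek Rec) k_inj); apply: JJf_inj.
  rewrite !linear0 -[LHS]fmap_comp; apply: fmap0 => [|x].
    exact/(right_adj_zero (adj_j_shriek Rec))/zero_fgP.
  exact: (sub_incP x).
have iKer : zero_mod (i_up Rec Ker).
  by apply: inj_zero (exact_fmap_inj i_up_exact k_inj) _; apply: i_up_j_shriek.
have /im_i_low[Z [e e_bij]] := jKer.
have [e' [eK e'K]] := bij_lin_inv e_bij.
have [phi [psi [_ psiK _ _ phi0]]] := adjoint0P (adj_i_up Rec).
have e'0 : e' = zero_lin _ _.
  rewrite -[LHS]psiK -(phi0 Ker Z); congr (phi _ _ _); apply: lin_ext => x.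
  by rewrite (iKer x) !linear0.
apply: lin_inj => x /(@sub_inc_surj _ _ (ker_sub Jf))[y <-].
by rewrite -(e'K y) e'0 zero_linE !linear0.
Qed.

Lemma j_shriek_exact : exact_functor (j_shriek Rec).
Proof.
move=> X Y Z f g [f_inj fg g_surj]; split.
- exact: j_shriek_inj.
- exact: (left_adj_exact (adj_j_shriek Rec)).
- exact: (left_adj_surj (adj_j_shriek Rec)).
Qed.

End Recollement.

(** * Induction along a ring map that is projective on the left *)

Section Opposite_morphism.
Variables (A R : pzRingType) (sigma : {rmorphism A -> R}).

Definition op_mor (a : A^c) : R^c := sigma a.

Fact op_mor_zmod : zmod_morphism op_mor.
Proof. exact: (rmorphB sigma). Qed.

Fact op_mor_monoid : monoid_morphism op_mor.
Proof.
by split=> [|a b]; [exact: (rmorph1 sigma) | exact: (rmorphM sigma)].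
Qed.

HB.instance Definition _ :=
  GRing.isZmodMorphism.Build A^c R^c op_mor op_mor_zmod.
HB.instance Definition _ :=
  GRing.isMonoidMorphism.Build A^c R^c op_mor op_mor_monoid.

Definition op_rmor : {rmorphism A^c -> R^c} := op_mor.

End Opposite_morphism.

(** The inclusion R -> A^n, by db_coef, and the retraction given by the
    generators present R as a direct summand of a free left A-module. *)
Record dual_basis (A R : pzRingType) (sigma : {rmorphism A -> R}) (n : nat) :=
  DualBasis {
    db_gen :> 'I_n -> R;
    db_coef : {linear restr_lmod sigma -> 'rV[A]_n};
    db_expand : forall r : R,
      \sum_i sigma (db_coef (r : restr_lmod sigma) 0 i) * db_gen i = r
  }.

(** Generators of R over K generate it over A, as K acts through A;
    projectivity splits the resulting map from A^n to R. *)
Lemma exists_dual_basis (K : fieldType) (A R : fdAlgType K)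
    (sigma : {rmorphism A -> R}) :
  alg_morphism sigma -> projective (restr_lmod sigma) ->
  exists n, inhabited (dual_basis sigma n).
Proof.
move=> sigmaK Rproj; have [n [g gP]] := fdalg_fin_dim R.
have c_surj : surjective (comb_map (g : 'I_n -> restr_lmod sigma)).
  apply: comb_surj => r; have [c cE] := gP r.
  exists (fun i => fdalg_scalar A (c i)); rewrite [LHS]cE.
  by apply: eq_bigr => i _; rewrite -sigmaK.
have [h hE] := Rproj _ _ (comb_map _) idfun c_surj.
by exists n; constructor; exists g h => r; exact: (hE r).
Qed.

Section Induction.
Variables (A R : pzRingType) (sigma : {rmorphism A -> R}) (n : nat).
Variable g : dual_basis sigma n.

(** The coefficient is taken in A^c, where it acts on right A-modules. *)
Definition dcoef (r : R) i : A^c := db_coef g (r : restr_lmod sigma) 0 i.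

Lemma dcoefD r s i : dcoef (r + s) i = dcoef r i + dcoef s i.
Proof. by rewrite /dcoef (linearD (db_coef g)) mxE. Qed.

Lemma dcoefM a r i : dcoef (sigma a * r) i = dcoef r i * (a : A^c).
Proof.
have := linearZZ (db_coef g) a (r : restr_lmod sigma).
by move/(congr1 (fun u : 'rV[A]_n => u 0 i)); rewrite mxE.
Qed.

Lemma dcoef_sum (I : finType) (F : I -> R) i :
  dcoef (\sum_j F j) i = \sum_j dcoef (F j) i.
Proof. by rewrite /dcoef (linear_sum (db_coef g)) summxE. Qed.

(** Expand r in the generators and use left A-linearity of the coefficients. *)
Lemma dcoef_act r s k :
  dcoef (r * s) k = \sum_j dcoef (g j * s) k * dcoef r j.
Proof.
rewrite -{1}(db_expand g r) mulr_suml dcoef_sum; apply: eq_bigr => j _.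
by rewrite -mulrA dcoefM.
Qed.

Section Module.
Variable M : lmodType A^c.

(** The right action of s on the coordinates of sum_j v_j (x) g_j. *)
Definition ind_act (v : {ffun 'I_n -> M}) (s : R) : {ffun 'I_n -> M} :=
  [ffun k => \sum_j dcoef (g j * s) k *: v j].

Lemma ind_actM v s s' : ind_act (ind_act v s) s' = ind_act v (s * s').
Proof.
apply/ffunP => k; rewrite !ffunE.
under eq_bigr => j _ do rewrite ffunE scaler_sumr.
rewrite exchange_big; apply: eq_bigr => i _ /=.
by rewrite mulrA dcoef_act scaler_suml; apply: eq_bigr => j _; rewrite scalerA.
Qed.

Lemma ind_actB u v s : ind_act (u - v) s = ind_act u s - ind_act v s.
Proof.
apply/ffunP => k; rewrite !ffunE -sumrB; apply: eq_bigr => j _.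
by rewrite !ffunE scalerBr.
Qed.

Lemma ind_actDr v s s' : ind_act v (s + s') = ind_act v s + ind_act v s'.
Proof.
apply/ffunP => k; rewrite !ffunE -big_split; apply: eq_bigr => j _ /=.
by rewrite mulrDr dcoefD scalerDl.
Qed.

Definition ind_stable : pred {ffun 'I_n -> M} := fun v => ind_act v 1 == v.

Fact ind_stable_closed : zmod_closed ind_stable.
Proof.
split=> [|u v]; rewrite !unfold_in /ind_stable.
  by rewrite -[X in ind_act X]subr0 ind_actB subrr.
by move=> /eqP u1 /eqP v1; rewrite ind_actB u1 v1.
Qed.

HB.instance Definition _ :=
  GRing.isZmodClosed.Build {ffun 'I_n -> M} ind_stable ind_stable_closed.

(** M (x)_A R: writing r as the sum of the coef_j(r) g_j splits R off A^n as a
    left A-module, so M (x)_A R is split off M^n as the fixed points of the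
    idempotent given by the action of 1. *)
Record induced := Induced {
  ind_val :> {ffun 'I_n -> M}; _ : ind_val \in ind_stable }.

HB.instance Definition _ := [isSub for ind_val].
HB.instance Definition _ := [Choice of induced by <:].
HB.instance Definition _ := [SubChoice_isSubZmodule of induced by <:].

Lemma induced1 (v : induced) : ind_act v 1 = v.
Proof. exact/eqP/(valP v). Qed.

Fact ind_act_stable v s : ind_act v s \in ind_stable.
Proof. by rewrite unfold_in /ind_stable ind_actM mulr1. Qed.

Definition ind_mk v s : induced := Induced (ind_act_stable v s).

Let scale (s : R^c) (v : induced) : induced := ind_mk v s.

Fact ind_scalerA a b v : scale a (scale b v) = scale (a * b) v.
Proof. by apply: val_inj; rewrite /= ind_actM. Qed.

Fact ind_scale1r : left_id 1 scale.
Proof. by move=> v; apply: val_inj; rewrite /= induced1. Qed.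

Fact ind_scalerDr : right_distributive scale +%R.
Proof.
move=> s u v; apply: val_inj; apply/ffunP => k; rewrite !ffunE -big_split.
by apply: eq_bigr => j _; rewrite ffunE scalerDr.
Qed.

Fact ind_scalerDl v : {morph scale^~ v : a b / a + b}.
Proof. by move=> a b; apply: val_inj; rewrite /= ind_actDr. Qed.

HB.instance Definition _ := GRing.Zmodule_isLmodule.Build R^c induced
  ind_scalerA ind_scale1r ind_scalerDr ind_scalerDl.

Lemma ind_scaleE (s : R) (v : induced) : val ((s : R^c) *: v) = ind_act v s.
Proof. by []. Qed.

Definition pure (m : M) (r : R) : {ffun 'I_n -> M} :=
  [ffun k => dcoef r k *: m].

Lemma pure_act m r s : ind_act (pure m r) s = pure m (r * s).
Proof.
apply/ffunP => k; rewrite !ffunE dcoef_act scaler_suml.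
by apply: eq_bigr => j _; rewrite ffunE scalerA.
Qed.

Fact pure_stable m r : pure m r \in ind_stable.
Proof. by rewrite unfold_in /ind_stable pure_act mulr1. Qed.

Definition tens m r : induced := Induced (pure_stable m r).

Lemma tensZ m r (s : R) : (s : R^c) *: tens m r = tens m (r * s).
Proof. by apply: val_inj; rewrite ind_scaleE pure_act. Qed.

Lemma tens_balanced : balanced (fun a r => sigma a * r) tens.
Proof.
split=> [m m' r|m r r'|m a r]; apply: val_inj; apply/ffunP => k; rewrite !ffunE.
- by rewrite scalerDr.
- by rewrite dcoefD scalerDl.
- by rewrite dcoefM scalerA.
Qed.

Lemma induced_expand (v : induced) :
  v = \sum_j (g j : R^c) *: tens (v j) 1.
Proof.
apply: val_inj; rewrite -[LHS]induced1 raddf_sum; apply/ffunP => k.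
rewrite ffunE sum_ffunE; apply: eq_bigr => j _.
by rewrite tensZ mul1r mulr1 ffunE.
Qed.

Fact tens1_lin :
  linear ((fun m => tens m 1) : M -> res_mod (op_rmor sigma) induced).
Proof.
have [tD _ tZ] := tens_balanced => a m m'.
rewrite tD tZ -[1 in LHS]/(1 : R) mulr1 -[sigma a]mul1r -tensZ.
by [].
Qed.

Definition tens1 : {linear M -> res_mod (op_rmor sigma) induced} :=
  lin_of tens1_lin.

Section Lift.
Variables (N : lmodType R^c) (f : {linear M -> res_mod (op_rmor sigma) N}).

(** The map M (x) R -> N adjoint to f, which sends m (x) r to f(m).r. *)
Definition ind_lift_fun (v : induced) : N :=
  \sum_j (g j : R^c) *: (f (v j) : N).

Fact ind_lift_lin : linear ind_lift_fun.
Proof.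
move=> s u v; rewrite /ind_lift_fun.
have -> : \sum_j (g j : R^c) *: (f ((s *: u + v) j) : N) =
    \sum_j (g j : R^c) *: (f ((s *: u) j) : N) +
    \sum_j (g j : R^c) *: (f (v j) : N).
  rewrite -big_split; apply: eq_bigr => j _ /=.
  by rewrite ffunE (linearD f) scalerDr.
congr (_ + _); rewrite scaler_sumr.
under eq_bigr => k _ do rewrite ind_scaleE ffunE (linear_sum f) scaler_sumr.
rewrite exchange_big; apply: eq_bigr => j _ /=.
rewrite scalerA -[s * _]/(g j * s : R) -[in RHS](db_expand g (g j * s)).
rewrite scaler_suml; apply: eq_bigr => k _.
by rewrite (linearZZ f) res_scaleE scalerA.
Qed.

Definition ind_lift : {linear induced -> N} := lin_of ind_lift_lin.

Lemma ind_lift_tens m r : ind_lift (tens m r) = (r : R^c) *: (f m : N).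
Proof.
rewrite /= /ind_lift_fun -[in RHS](db_expand g r) scaler_suml.
apply: eq_bigr => k _.
by rewrite ffunE (linearZZ f) res_scaleE scalerA.
Qed.

End Lift.

(** The tensors m (x) 1 generate M (x) R over R. *)
Lemma induced_lin (N : lmodType R^c) (f : {linear induced -> N}) (v : induced) :
  f v = \sum_j (g j : R^c) *: f (tens (v j) 1).
Proof.
rewrite {1}[v]induced_expand linear_sum; apply: eq_bigr => j _.
by rewrite linearZ.
Qed.

End Module.

Lemma induced_fin_gen (M : lmodType A^c) : fin_gen M -> fin_gen (induced M).
Proof.
case=> p [h hP].
exists p, (fun i => tens1 M (h i) : induced M) => v.
have /choice[c cE] j : exists c : 'I_p -> A^c, v j = \sum_i c i *: h i.
  exact: hP.
exists (fun i => \sum_j (g j : R^c) * op_rmor sigma (c j i)).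
rewrite [LHS]induced_expand.
under [RHS]eq_bigr => i _ do rewrite scaler_suml.
rewrite exchange_big; apply: eq_bigr => j _ /=.
rewrite -[tens (v j) 1]/(tens1 M (v j)) cE (linear_sum (tens1 M)) scaler_sumr.
by apply: eq_bigr => i _; rewrite (linearZZ (tens1 M)) res_scaleE scalerA.
Qed.

Section Map.
Variables (M N : lmodType A^c) (f : {linear M -> N}).

Definition ffun_map (v : {ffun 'I_n -> M}) : {ffun 'I_n -> N} :=
  [ffun k => f (v k)].

Lemma ffun_map_act v s : ffun_map (ind_act v s) = ind_act (ffun_map v) s.
Proof.
apply/ffunP => k; rewrite !ffunE linear_sum; apply: eq_bigr => j _.
by rewrite ffunE linearZ.
Qed.

Fact ffun_map_stable (v : induced M) : ffun_map v \in @ind_stable N.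
Proof. by rewrite unfold_in /ind_stable -ffun_map_act induced1. Qed.

Definition ind_map_fun v : induced N := Induced (ffun_map_stable v).

Fact ind_map_lin : linear ind_map_fun.
Proof.
move=> s u v; apply: val_inj; apply/ffunP => k.
rewrite !ffunE linearD; congr (_ + _).
by rewrite linear_sum; apply: eq_bigr => j _; rewrite ffunE linearZ.
Qed.

Definition ind_map : {linear induced M -> induced N} := lin_of ind_map_lin.

Lemma ind_mapE v k : ind_map v k = f (v k).
Proof. by rewrite ffunE. Qed.

Lemma ind_map_tens m r : ind_map (tens m r) = tens (f m) r.
Proof. by apply: val_inj; apply/ffunP => k; rewrite !ffunE linearZ. Qed.

End Map.

Definition induction : mod_functor A R.
Proof.
apply: (@ModFunctor A R (fun M => FgMod (induced_fin_gen (fgmod_fin_gen M)))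
  (fun M N f => ind_map f)).
- by move=> M v; apply: val_inj; apply/ffunP => k; rewrite ind_mapE.
- by move=> L M N u f v; apply: val_inj; apply/ffunP => k; rewrite !ind_mapE.
Defined.

(** The fixed points of a natural idempotent of the exact functor sending M to
    M^n form an exact functor: preimages taken coordinatewise are corrected by
    the idempotent. *)
Lemma induction_exact : exact_functor induction.
Proof.
move=> X Y Z f h [f_inj fh h_surj].
have lift (U V : fgmod A) (k : {linear U -> V}) (v : induced V) :
    (forall i, exists u, k u = v i) -> exists u, ind_map k u = v.
  move=> /choice[u uE]; exists (ind_mk (finfun u) 1); apply: val_inj.
  rewrite -[LHS]/(ffun_map k _) ffun_map_act -[RHS]induced1.
  by congr (ind_act _ _); apply/ffunP => i; rewrite !ffunE uE.
split.
- move=> u v uv; apply: val_inj; apply/ffunP => k; apply: f_inj.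
  by have := congr1 (fun w : induced Y => w k) uv; rewrite !ffunE.
- move=> v; split=> [hv|[u <-]].
    apply: lift => i; apply/fh.
    by have := congr1 (fun w : induced Z => w i) hv; rewrite !ffunE.
  apply: val_inj; apply/ffunP => k; rewrite !ffunE; apply/fh.
  by exists (u k).
- by move=> v; apply: lift => i; apply: h_surj.
Qed.

(** Maps from P (x) R to Y over R are maps from P to the restriction of Y
    over A, and restriction preserves surjections. *)
Lemma induction_projective (P : fgmod A) :
  projective P -> projective (induction P).
Proof.
move=> Pproj X Y h f h_surj.
pose f0 : {linear P -> res_mod (op_rmor sigma) Y} :=
  res_lin (op_rmor sigma) (f : {linear induced P -> Y}) \o tens1 P.
have [k kE] := Pproj _ _ (res_lin (op_rmor sigma) h) f0 h_surj.
exists (ind_lift k) => v; rewrite [RHS](induced_lin (N := Y)).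
rewrite /= /ind_lift_fun linear_sum; apply: eq_bigr => j _.
by rewrite linearZZ -[h (k _)]/(res_lin (op_rmor sigma) h (k _)) kE.
Qed.

End Induction.

(** * Tensor products by their universal property *)

Section Tensor.
Variables (A S : pzRingType) (M : lmodType A^c) (Q : zmodType).
Variables (lact : A -> Q -> Q) (ract : Q -> S -> Q).
Variables (T : lmodType S^c) (t : M -> Q -> T).
Hypothesis tT : is_tensor lact ract t.

(** The uniqueness half of the universal property. *)
Lemma tensor_ext (Z : zmodType) (f h : {additive T -> Z}) :
  (forall m q, f (t m q) = h (t m q)) -> f =1 h.
Proof.
have [[tDl tDr tZ] _ tU] := tT => fh.
have [|k [_ kU]] := tU Z (fun m q => h (t m q)).
  by split=> *; rewrite ?tDl ?tDr ?tZ ?raddfD.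
by move=> x; rewrite (kU f fh) (kU h).
Qed.

(** An additive map that commutes with the action of s on pure tensors commutes
    with it everywhere. *)
Lemma tensor_scale (Z : zmodType) (f : {additive T -> Z}) (s : S)
    (w : {additive Z -> Z}) :
  (forall m q, f (t m (ract q s)) = w (f (t m q))) ->
  forall x, f ((s : S^c) *: x) = w (f x).
Proof.
have [_ tS _] := tT => fw.
apply: (@tensor_ext Z (f \o *:%R (s : S^c)) (w \o f)) => m q.
by rewrite /= -tS fw.
Qed.

(** The map tau allows for maps that are linear over a ring acting through S,
    such as A-linear maps out of M (x)_A R. *)
Lemma tensor_lift (A' : pzRingType) (tau : {rmorphism A'^c -> S^c})
    (N : lmodType A'^c) (b : M -> Q -> N) :
  balanced lact b ->
  (forall m q (a : A'), b m (ract q (tau a)) = (a : A'^c) *: b m q) ->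
  exists f : {linear res_mod tau T -> N}, forall m q, f (t m q) = b m q.
Proof.
have [_ _ tU] := tT => b_bal bZ; have [f [fE _]] := tU N b b_bal.
have f_lin : linear (f : res_mod tau T -> N).
  move=> a x y; rewrite raddfD; congr (_ + _).
  rewrite res_scaleE; apply: (tensor_scale (w := *:%R a)) => m q.
  by rewrite !fE bZ.
by exists (lin_of f_lin).
Qed.

End Tensor.

(** * Extension of scalars along a split extension *)

Section Split_extension.
Variables (K : closedFieldType) (R A : fdAlgType K).
Variables (xi : {rmorphism R -> A}) (sigma : {rmorphism A -> R}).
Hypothesis sigmaK : cancel sigma xi.

Local Notation res := (res_mod (op_rmor sigma)).

Fact ker_part_in (r : R) : r - sigma (xi r) \in in_ker xi.
Proof. by rewrite unfold_in /in_ker rmorphB sigmaK subrr. Qed.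

Definition ker_part (r : R) : kernel xi := Kernel (ker_part_in r).

Lemma ker_partD r r' : ker_part (r + r') = ker_part r + ker_part r'.
Proof. by apply: val_inj; rewrite /= !rmorphD opprD addrACA. Qed.

Lemma ker_part_lact a r :
  ker_part (sigma a * r) = ker_lact sigma a (ker_part r).
Proof. by apply: val_inj; rewrite /= mulrBr !rmorphM sigmaK. Qed.

Lemma ker_part_ract r a :
  ker_part (r * sigma a) = ker_ract sigma (ker_part r) a.
Proof. by apply: val_inj; rewrite /= mulrBl !rmorphM sigmaK. Qed.

(** As an (A, A)-bimodule R is A + Ker xi, hence M (x)_A R restricted to A is
    M + M (x)_A Ker xi. *)
Lemma tensor_ext_split (M MQ : fgmod A) (tQ : M -> kernel xi -> MQ)
    (MR : fgmod R) (tR : M -> R -> MR) :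
  is_tensor_ker sigma tQ -> is_tensor_ext sigma tR ->
  exists (s : {linear M -> res MR}) (p : {linear res MR -> M})
         (i : {linear MQ -> res MR}) (q : {linear res MR -> MQ}),
    [/\ forall x, x = s (p x) + i (q x), forall m, s m = tR m 1
      & cancel s p].
Proof.
move=> tQT tRT; have [[tQDl tQDr tQZ] tQS _] := tQT.
have [[tRDl tRDr tRZ] tRS _] := tRT.
have s_lin : linear ((fun m => tR m 1) : M -> res MR).
  move=> a m m'; rewrite tRDl tRZ mulr1 -[sigma a]mul1r tRS.
  by [].
have [|m r a|p pE] := @tensor_lift _ _ _ _ _ _ _ _ tRT A (op_rmor sigma) M
    (fun m r => (xi r : A^c) *: m).
- split=> [m m' r|m r r'|m a r]; first by rewrite scalerDr.
    by rewrite rmorphD scalerDl.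
  by rewrite scalerA rmorphM sigmaK.
- by rewrite scalerA rmorphM sigmaK.
have [|m r a|q qE] := @tensor_lift _ _ _ _ _ _ _ _ tRT A (op_rmor sigma) MQ
    (fun m r => tQ m (ker_part r)).
- split=> [m m' r|m r r'|m a r]; first exact: tQDl.
    by rewrite ker_partD tQDr.
  by rewrite ker_part_lact tQZ.
- by rewrite ker_part_ract tQS.
have [|m r a|i iE] := @tensor_lift _ _ _ _ _ _ _ _ tQT A idfun (res MR)
    (fun m z => tR m (val z)).
- split=> [m m' r|m r r'|m a r]; first exact: tRDl.
    exact: tRDr.
  exact: tRZ.
- exact: tRS.
have i_lin : linear (i : MQ -> res MR) by move=> a x y; exact: (linearP i).
exists (lin_of s_lin), p, (lin_of i_lin), q; split=> // [x|m]; last first.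
  by rewrite pE rmorph1 scale1r.
pose f : {linear res MR -> res MR} :=
  (lin_of s_lin \o p) \+ (lin_of i_lin \o q).
apply: (@tensor_ext _ _ _ _ _ _ _ _ tRT (res MR) idfun f) => m r.
by rewrite /= pE qE iE tRZ mulr1 -tRDr addrC subrK.
Qed.

(** Both modules have the universal property of M (x)_A R; one of the two
    maps is the adjoint of m |-> m (x) 1, which makes it R-linear. *)
Lemma tensor_ext_iso n (g : dual_basis sigma n) (M : fgmod A) (MR : fgmod R)
    (tR : M -> R -> MR) :
  is_tensor_ext sigma tR ->
  exists e : {linear induction g M -> MR},
    bijective e /\ forall m r, e (tens g m r) = tR m r.
Proof.
move=> tRT; have [[tRDl tRDr tRZ] tRS tRU] := tRT.
have s_lin : linear ((fun m => tR m 1) : M -> res MR).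
  move=> a m m'; rewrite tRDl tRZ mulr1 -[sigma a]mul1r tRS.
  by [].
pose e : {linear induction g M -> MR} := ind_lift g (lin_of s_lin).
have eE m r : e (tens g m r) = tR m r.
  by rewrite [LHS](ind_lift_tens g) -tRS mul1r.
have [b [bE _]] := tRU _ _ (tens_balanced g M).
exists e; split=> //; exists b => [v|x]; last first.
  apply: (@tensor_ext _ _ _ _ _ _ _ _ tRT MR (e \o b) idfun) => m r.
  by rewrite -[LHS]/(e (b (tR m r))) bE eE.
rewrite {2}[v](induced_expand (M := M)) {1}[v](induced_expand (M := M)).
rewrite linear_sum raddf_sum; apply: eq_bigr => j _.
by rewrite tensZ eE bE.
Qed.

Hypothesis sigma_alg : alg_morphism sigma.
Hypothesis R_proj : projective (restr_lmod sigma).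

Section Pair.
Variables (M : fgmod A) (MR : fgmod R) (tR : M -> R -> MR).
Hypothesis tRT : is_tensor_ext sigma tR.
Variables (N NQ : fgmod A) (uQ : N -> kernel xi -> NQ).
Variables (NR : fgmod R) (uR : N -> R -> NR).
Hypotheses (uQT : is_tensor_ker sigma uQ) (uRT : is_tensor_ext sigma uR).

Lemma tensor_ext_hom_ext (f h : {linear MR -> NR}) :
  (forall m, f (tR m 1) = h (tR m 1)) -> f =1 h.
Proof.
move=> fh; apply: (tensor_ext tRT) => m r; have [_ tRS _] := tRT.
have kr (k : {linear MR -> NR}) : k (tR m r) = (r : R^c) *: k (tR m 1).
  by rewrite -{1}[r]mul1r tRS linearZZ.
by rewrite [LHS]kr fh -[LHS]kr.
Qed.

Fact hom_restr_lin (f : {linear MR -> NR}) :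
  linear ((fun m => f (tR m 1)) : M -> res NR).
Proof.
have [[tRDl _ tRZ] tRS _] := tRT.
move=> a m m'; rewrite tRDl tRZ mulr1 -[sigma a]mul1r tRS linearP.
by [].
Qed.

(** The adjoint of f : M (x) R -> N (x) R. *)
Definition hom_restr f : {linear M -> res NR} := lin_of (hom_restr_lin f).

Lemma tensor_ext_hom_zero :
  hom_zero M N -> hom_zero M NQ -> hom_zero MR NR.
Proof.
move=> MN0 MNQ0 f; have [s [p [i [q [spiq _ _]]]]] := tensor_ext_split uQT uRT.
apply: (@tensor_ext_hom_ext f (zero_lin _ _)) => m.
rewrite -[LHS]/(hom_restr f m) [LHS]spiq.
rewrite -[p _]/((p \o hom_restr f) m) MN0 -[q _]/((q \o hom_restr f) m) MNQ0.
by rewrite !linear0 addr0.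
Qed.

(** Ext_R(M (x) R, N (x) R) is Ext_A(M, N (x) R): inducing a projective
    resolution of M gives one of M (x) R, as R is projective over A. *)
Lemma tensor_ext_ext_zero n :
  (0 < n)%N -> ext_zero n M N -> ext_zero n M NQ -> ext_zero n MR NR.
Proof.
case: n => // n _ MN0 MNQ0.
have [s [p [i [q [spiq _ _]]]]] := tensor_ext_split uQT uRT.
have [d [g]] := exists_dual_basis sigma_alg R_proj.
have [e [e_bij _]] := tensor_ext_iso g tRT.
pose P := std_resolution M.
apply: (@ext_zero_resolution _ _ _ (map_resolution (@induction_exact _ _ _ _ g)
  (@induction_projective _ _ _ _ g) P e_bij)) => f f_cocycle.
pose fA : {linear pr_obj P n.+1 -> res NR} :=
  res_lin (op_rmor sigma) (f : {linear induced g _ -> NR}) \o tens1 g _.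
have fA_cocycle x : fA (pr_diff P n.+1 x) = 0.
  have := f_cocycle (tens g x 1); rewrite [X in f X](ind_map_tens g).
  by [].
have [|g1 g1E] := MN0 P (p \o fA).
  by move=> x; rewrite -[LHS]/(p (fA _)) fA_cocycle linear0.
have [|g2 g2E] := MNQ0 P (q \o fA).
  by move=> x; rewrite -[LHS]/(q (fA _)) fA_cocycle linear0.
exists (ind_lift g ((s \o g1) \+ (i \o g2))) => v.
rewrite [LHS](induced_lin (N := NR)); apply: eq_bigr => j _; congr (_ *: _).
by rewrite -[LHS]/(fA (v j)) [LHS]spiq ffunE /= -g1E -g2E.
Qed.

End Pair.

(** The adjoint of an endomorphism of M (x) R is a map from M to M + M (x) Q.
    Its second component vanishes and the first is a scalar, so the
    endomorphism is multiplication by that scalar. *)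
Lemma tensor_ext_scalar_end (M MQ : fgmod A) (tQ : M -> kernel xi -> MQ)
    (MR : fgmod R) (tR : M -> R -> MR) :
  is_tensor_ker sigma tQ -> is_tensor_ext sigma tR ->
  scalar_end M -> hom_zero M MQ -> scalar_end MR.
Proof.
move=> tQT tRT M_scal MMQ0 f.
have [s [p [i [q [spiq sE _]]]]] := tensor_ext_split tQT tRT.
pose fA := hom_restr tRT f; have [k kP] := M_scal (p \o fA).
exists k => x; apply: (tensor_ext_hom_ext tRT (h := scal_lin MR k)) => m.
rewrite -[LHS]/(fA m) [LHS]spiq -[q _]/((q \o fA) m) MMQ0 linear0 addr0.
rewrite -[p _]/((p \o fA) m) kP linearZZ sE res_scaleE.
by rewrite /= -[op_rmor sigma _]/(sigma (fdalg_scalar A k)) sigma_alg.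
Qed.

Lemma tensor_ext_nonzero (M MQ : fgmod A) (tQ : M -> kernel xi -> MQ)
    (MR : fgmod R) (tR : M -> R -> MR) :
  is_tensor_ker sigma tQ -> is_tensor_ext sigma tR ->
  ~ zero_mod M -> ~ zero_mod MR.
Proof.
move=> tQT tRT M0 MR0; apply: M0.
have [s [p [_ [_ [_ _ sK]]]]] := tensor_ext_split tQT tRT.
by move=> m; rewrite -(sK m) (MR0 (s m)) linear0.
Qed.

End Split_extension.

Theorem theorem1p2 (K : closedFieldType) (A R A' A'' : fdAlgType K)
    (xi : {rmorphism R -> A}) (sigma : {rmorphism A -> R})
    (split_xi : split_extension xi sigma)
    (Rec : recollement A' A A'') :
  (forall (r : nat) (M : 'I_r -> fgmod A)
      (MQ : 'I_r -> fgmod A) (tQ : forall k, M k -> kernel xi -> MQ k)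
      (MR : 'I_r -> fgmod R) (tR : forall k, M k -> R -> MR k),
    (forall k, is_tensor_ker sigma (tQ k)) ->
    (forall k, is_tensor_ext sigma (tR k)) ->
    exceptional_seq M ->
    projective (restr_lmod sigma) ->
    (forall k, hom_zero (M k) (MQ k)) ->
    (forall i j : 'I_r, (i < j)%N -> hom_zero (M j) (MQ i)) ->
    (forall n : nat, (0 < n)%N ->
       (forall k, ext_zero n (M k) (MQ k)) /\
       (forall i j : 'I_r, (i < j)%N -> ext_zero n (M j) (MQ i))) ->
    exceptional_seq MR)
  /\
  (forall (t u : nat) (X : 'I_t -> fgmod A') (Y : 'I_u -> fgmod A''),
    exceptional_seq X ->
    exceptional_seq Y ->
    exact_functor (i_up Rec) ->
    exact_functor (i_shriek Rec) ->
    exceptional_seq (fun k => i_low Rec (X k)) /\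
    exceptional_seq (fun k => j_shriek Rec (Y k))).
Proof.
have [_ sigma_alg _ sigmaK _] := split_xi.
split=> [r M MQ tQ MR tR tQT tRT [M_exc M_pair] R_proj homQ homQij extQ|].
  split=> [k|i j ij].
    have [[M0 _] M_end M_ext] := M_exc k.
    apply: scalar_end_exceptional.
    - exact: (tensor_ext_nonzero sigmaK (tQT k) (tRT k)).
    - apply: (tensor_ext_scalar_end sigmaK sigma_alg (tQT k) (tRT k)) => //.
      exact: end_iso_scalar.
    - move=> n n0; have [extQk _] := extQ n n0.
      apply: (tensor_ext_ext_zero sigmaK sigma_alg R_proj
        (tRT k) (tQT k) (tRT k)) => //.
      exact: M_ext.
  have [M_hom M_ext] := M_pair _ _ ij; split=> [|n n0].
    apply: (tensor_ext_hom_zero sigmaK (tRT j) (tQT i) (tRT i)) => //.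
    exact: homQij.
  have [_ extQij] := extQ n n0.
  apply: (tensor_ext_ext_zero sigmaK sigma_alg R_proj
    (tRT j) (tQT i) (tRT i)) => //.
    exact: M_ext.
  exact: extQij.
move=> t u X Y X_exc Y_exc iu_exact ish_exact; split.
- apply: ff_exceptional_seq X_exc; first exact: ff_i_low.
    exact: i_low_exact.
  exact: i_low_projective.
- apply: ff_exceptional_seq Y_exc; first exact: ff_j_shriek.
    exact: j_shriek_exact.
  exact: j_shriek_projective.
Qed.
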